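(* For all finite fields $\mathbb{F}_q$ and all $a\in\mathrm{GL}_n(\mathbb{F}_q)$ we have $$|K_n(a)|\ll_n q^{(3n^2-\delta(n))/4},$$ where $\delta(n)=0$ if $n$ is even and $\delta(n)=1$ if $n$ is odd. That is, for every $n\ge 1$ there is a constant $C_n$ depending only on $n$ such that $|K_n(a)|\le C_n\,q^{(3n^2-\delta(n))/4}$ for every finite field $\mathbb{F}_q$ and every $a\in\mathrm{GL}_n(\mathbb{F}_q)$.
   Context: $\mathbb{F}_q$ is a finite field of characteristic $p$. The additive character $\varphi:\mathbb{F}_q\to\mathbb{C}^*$ is $\varphi(x)=\exp(2\pi i\,\mathrm{Tr}_{\mathbb{F}_q/\mathbb{F}_p}(x)/p)$, and $\psi=\varphi\circ\mathrm{tr}$ on $M_n(\mathbb{F}_q)$, where $\mathrm{tr}$ is the matrix trace. For $a\in M_n(\mathbb{F}_q)$, $K_n(a)=\sum_{x\in \mathrm{GL}_n(\mathbb{F}_q)}\psi(ax+x^{-1})$. *)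

(* Defs.v *)
From HB Require Import structures.
From mathcomp Require Import all_boot all_order all_algebra all_fingroup all_solvable all_field.
From mathcomp Require Import complex.
From mathcomp Require Import all_classical all_reals all_analysis.

Set Implicit Arguments.
Unset Strict Implicit.
Unset Printing Implicit Defensive.

Import Order.TTheory GRing.Theory Num.Theory.

Local Open Scope ring_scope.
Local Open Scope complex_scope.

(* MathComp-Analysis has no complex exponential; this is
   exp (x + i y) = e^x (cos y + i sin y). *)
Definition cexp (R : realType) (z : R[i]) : R[i] :=
  (expR (complex.Re z))%:C * (cos (complex.Im z) +i* sin (complex.Im z)).

(* pPrimeCharType chFp is F itself, seen as an extension of 'F_p. The library
   trace galTrace takes its values in the prime subfield 1%VS of F; its
   coordinate on the basis [:: 1] is the corresponding element of 'F_p. *)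
Definition absTrace (F : finFieldType) (p : nat) (chFp : p \in [pchar F])
    (x : F) : 'F_p :=
  coord [tuple (1 : pPrimeCharType chFp)] ord0
    (galTrace 1%AS {:pPrimeCharType chFp}%AS (x : pPrimeCharType chFp)).

Lemma absTraceE (F : finFieldType) (p : nat) (chFp : p \in [pchar F]) (x : F) :
  (absTrace chFp x)%:A =
  galTrace 1%AS {:pPrimeCharType chFp}%AS (x : pPrimeCharType chFp).
Proof.
set K := pPrimeCharType chFp; set v := galTrace _ _ _.
have gal1 : galois (1%AS : {subfield K}) {:K}%AS by exact: finField_galois (sub1v _).
have v1 : v \in <<[tuple (1%R : K)]>>%VS.
  rewrite span_seq1 -[<[1]>%VS](galois_fixedField gal1).
  exact: galTrace_fixedField (memvf _).
by rewrite [RHS](coord_span v1) big_ord1.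
Qed.

Definition addChar (R : realType) (F : finFieldType) (p : nat)
    (chFp : p \in [pchar F]) (x : F) : R[i] :=
  cexp (2 * (pi : R)%:C * 'i%C * (absTrace chFp x : nat)%:R / p%:R).

Definition mxChar (R : realType) (F : finFieldType) (p : nat)
    (chFp : p \in [pchar F]) (n : nat) (x : 'M[F]_n) : R[i] :=
  addChar R chFp (\tr x).

Definition Kloosterman (R : realType) (F : finFieldType) (p : nat)
    (chFp : p \in [pchar F]) (n : nat) (a : 'M[F]_n) : R[i] :=
  \sum_(x : 'M[F]_n | x \in unitmx) mxChar R chFp (a *m x + invmx x).

Definition delta (n : nat) : nat := if odd n then 1 else 0.

(* Main.v *)
Require Import Defs.
From HB Require Import structures.
From mathcomp Require Import all_boot all_order all_algebra all_fingroup all_solvable all_field.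
From mathcomp Require Import complex.
From mathcomp Require Import all_classical all_reals all_analysis.
From mathcomp Require Import ring lra zify.
Import Order.TTheory GRing.Theory Num.Theory.
Local Open Scope ring_scope.
Local Open Scope complex_scope.
Set Implicit Arguments.
Unset Strict Implicit.
Unset Printing Implicit Defensive.

(** The proof bounds K_n(a) for every matrix a, by induction on n, with three
  ingredients.

  1. If a has no eigenvector over F_q, a second moment is enough. Parseval's
  identity gives sum_b |K_n(b)|^2 = q^(n^2) |GL_n| (mxKloos_parseval), and K_n is
  constant on the conjugacy class of a. Each new generator of the F_q[a]-module
  F_q^n adds at least two dimensions to the submodule generated so far, so that
  the centralizer of a has at most q^(n (n / 2)) elements, with n / 2 rounded
  down. Hence |K_n(a)|^2 <= q^(n^2 + n (n / 2)) (mxKloos_eigenfree_bound).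

  2. If v a = alpha v with v nonzero, translating x by unipotents shows that only
  the x with alpha v x - v x^-1 in the line of v contribute (mxKloos_eigenvector).
  For such an x, either v spans a stable line, or v and w = v x span a stable
  plane on which x acts by one of q matrices. Sums over the x with a given action
  on a stable subspace of dimension k reduce to K_(n-k) (sum_stable_subspace), and
  |K_n| <= q^n max|K_(n-1)| + q^(3n-3) max|K_(n-2)| (mxKloos_eigenvector_bound).
  The second term makes the exponent 3n^2/4 grow exactly as it should, so the
  whole bound rests on n = 0 and n = 1.

  3. For n = 1 this is Weil's bound |K| <= 2 sqrt q (weil_kloosterman). Going to
  the quadratic extension of a field of order Q, with the trace of the character,
  replaces K by 2 Q - K^2 (kloos1_quadratic): the normalized sum k = K / sqrt Q
  becomes 2 - k^2. Iterating, |k| > 2 would make k unbounded. But k is bounded by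
  a constant that depends on q only: when Q = r^2 is a square, Stepanov's method
  bounds by r^2 + O(q r) the number of points of each curve
  x + a / x = b + y^q - y (card_artin_schreier), and K is a combination of
  these numbers in which their common main term cancels (kloos1_square_order).
  Stepanov's method is run in the ring E[y][x] / (x^2 - h(y) x + a): a counting
  argument produces a nonzero function Psi = A(y) + B(y) x of weight about r^2 / 2
  whose r-th power vanishes at all rational points (card_splitPoints_aux), and
  norms show that it is not identically zero (frob_combination_inj). *)

(** * Quadratic algebras *)

(** The pair (z1, z2) stands for z1 + z2 x in P[x] / (x^2 - h x + a). Over
  P = E[y], with a constant, this is the ring of the affine curve
  x + a / x = h(y). *)
Definition quadAlg (P : comNzRingType) (h a : P) : Type := (P * P)%type.

Section QuadAlg.
Variables (P : comNzRingType) (h a : P).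
Local Notation QA := (quadAlg h a).

HB.instance Definition _ := GRing.Zmodule.copy QA (P * P)%type.

Definition qmul (z w : QA) : QA :=
  (z.1 * w.1 - a * z.2 * w.2, z.1 * w.2 + z.2 * w.1 + h * z.2 * w.2).

Definition qone : QA := (1, 0).

Lemma qmulA : associative qmul.
Proof. by move=> x y z; congr (_, _); rewrite /=; ring. Qed.

Lemma qmulC : commutative qmul.
Proof. by move=> x y; congr (_, _); rewrite /=; ring. Qed.

Lemma qmul1 : left_id qone qmul.
Proof. by case=> x y; congr (_, _); rewrite /=; ring. Qed.

Lemma qmulDl : left_distributive qmul +%R.
Proof. by move=> x y z; congr (_, _); rewrite /=; ring. Qed.

Lemma qone_neq0 : qone != 0 :> QA.
Proof. by apply/negP=> /eqP [] /eqP; rewrite oner_eq0. Qed.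

HB.instance Definition _ :=
  GRing.Zmodule_isComNzRing.Build QA qmulA qmulC qmul1 qmulDl qone_neq0.

Definition qgen : QA := (0, 1).

Definition qconst (c : P) : QA := (c, 0).

Lemma qconst_is_additive : {morph qconst : c d / c - d}.
Proof. by move=> c d; congr (_, _); rewrite /= subrr. Qed.
HB.instance Definition _ :=
  GRing.isZmodMorphism.Build P QA qconst qconst_is_additive.

Lemma qconst_is_multiplicative : monoid_morphism qconst.
Proof. by split=> // c d; congr (_, _); rewrite /=; ring. Qed.
HB.instance Definition _ :=
  GRing.isMonoidMorphism.Build P QA qconst qconst_is_multiplicative.

Definition qconj (z : QA) : QA := (z.1 + h * z.2, - z.2).
Definition qtrace (z : QA) : P := z.1 *+ 2 + h * z.2.
Definition qnorm (z : QA) : P := z.1 ^+ 2 + h * z.1 * z.2 + a * z.2 ^+ 2.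

Lemma qconj_is_additive : {morph qconj : c d / c - d}.
Proof. by move=> c d; congr (_, _); rewrite /=; ring. Qed.
HB.instance Definition _ :=
  GRing.isZmodMorphism.Build QA QA qconj qconj_is_additive.

Lemma qconj_is_multiplicative : monoid_morphism qconj.
Proof. by split=> [|c d]; congr (_, _); rewrite /=; ring. Qed.
HB.instance Definition _ :=
  GRing.isMonoidMorphism.Build QA QA qconj qconj_is_multiplicative.

Lemma qtraceE z : qconst (qtrace z) = z + qconj z.
Proof. by congr (_, _); rewrite /qtrace /=; ring. Qed.

Lemma qnormE z : qconst (qnorm z) = z * qconj z.
Proof. by congr (_, _); rewrite /qnorm /=; ring. Qed.

Lemma qconst_inj : injective qconst.
Proof. by move=> c d []. Qed.

Lemma qnormM z w : qnorm (z * w) = qnorm z * qnorm w.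
Proof. by rewrite /qnorm /=; ring. Qed.

Lemma qnorm_const c : qnorm (qconst c) = c ^+ 2.
Proof. by rewrite /qnorm /=; ring. Qed.

Lemma qnorm_gen : qnorm qgen = a.
Proof. by rewrite /qnorm /=; ring. Qed.

Lemma qnormX z n : qnorm (z ^+ n) = qnorm z ^+ n.
Proof.
elim: n => [|n IHn]; first by rewrite !expr0 /qnorm /=; ring.
by rewrite !exprS qnormM IHn.
Qed.

Lemma qnormN z : qnorm (- z) = qnorm z.
Proof. by rewrite /qnorm /=; ring. Qed.

Lemma qnormD z w : qnorm (z + w) = qnorm z + qtrace (z * qconj w) + qnorm w.
Proof. by rewrite /qnorm /qtrace /=; ring. Qed.

Lemma qtraceMl c z : qtrace (qconst c * z) = c * qtrace z.
Proof. by rewrite /qtrace /=; ring. Qed.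

Lemma qtraceN z : qtrace (- z) = - qtrace z.
Proof. by rewrite /qtrace /=; ring. Qed.

(** Frobenius applied to x + conj x = h. *)
Lemma qtrace_genX r : [pchar P].-nat r -> qtrace (qgen ^+ r) = h ^+ r.
Proof.
move=> rch; apply: qconst_inj.
have rchQ : [pchar QA].-nat r.
  by apply: sub_in_pnat rch => p _ /(rmorph_pchar qconst).
rewrite qtraceE rmorphXn /= -exprDn_pchar // -qtraceE rmorphXn /=.
by congr (qconst _ ^+ r); rewrite /qtrace /=; ring.
Qed.

Variables (T : comNzRingType) (f : {rmorphism P -> T}) (x : T).
Definition qeval (z : QA) : T := f z.1 + f z.2 * x.

Lemma qeval_add : {morph qeval : z w / z + w}.
Proof. by move=> z w; rewrite /qeval /= !rmorphD mulrDl addrACA. Qed.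

Lemma qeval_const c : qeval (qconst c) = f c.
Proof. by rewrite /qeval rmorph0 mul0r addr0. Qed.

Lemma qeval_gen : qeval qgen = x.
Proof. by rewrite /qeval rmorph0 rmorph1 mul1r add0r. Qed.

Hypothesis root_x : x ^+ 2 = f h * x - f a.

Lemma qevalM : {morph qeval : z w / z * w}.
Proof.
move=> z w; rewrite /qeval /= rmorphB !rmorphD !rmorphM.
have -> : (f z.1 + f z.2 * x) * (f w.1 + f w.2 * x) =
  f z.1 * f w.1 + (f z.1 * f w.2 + f z.2 * f w.1) * x
  + f z.2 * f w.2 * (x ^+ 2) by ring.
by rewrite root_x; ring.
Qed.

Lemma qevalX z n : qeval (z ^+ n) = qeval z ^+ n.
Proof.
elim: n => [|n IHn]; last by rewrite !exprS qevalM IHn.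
by rewrite !expr0 -[1]/(qconst 1) qeval_const rmorph1.
Qed.

End QuadAlg.

(** * Weights and norms on the curve x + a / x = h(y) *)

Section Weight.
Variables (E : fieldType) (d : nat) (h : {poly E}) (a : E).
Hypotheses (d_gt0 : (0 < d)%N) (size_h : size h = d.+1) (a_neq0 : a != 0).
Local Notation QA := (quadAlg h a%:P).

(** Elements of weight less than w, when y weighs 1 and x weighs d: the weight
  bounds the pole orders at the two points at infinity. The subtraction is
  truncated, so that 0 is the only element with w = 0. *)
Definition wlt (w : nat) (z : QA) := (size z.1 <= w)%N && (size z.2 <= w - d)%N.

Lemma wlt_leq v w z : (v <= w)%N -> wlt v z -> wlt w z.
Proof.
by move=> vw /andP[z1 z2]; apply/andP; split; [apply: leq_trans z1 vw|lia].
Qed.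

Lemma wlt0 w : wlt w 0.
Proof. by rewrite /wlt /= size_poly0 !leq0n. Qed.

Lemma wlt0_eq0 z : wlt 0 z -> z = 0.
Proof.
case: z => x y /andP[/=]; rewrite sub0n !leqn0 !size_poly_eq0.
by move=> /eqP-> /eqP->.
Qed.

Lemma wltD w z z' : wlt w z -> wlt w z' -> wlt w (z + z').
Proof.
move=> /andP[z1 z2] /andP[z1' z2']; apply/andP; split.
  by rewrite (leq_trans (size_polyD _ _))// geq_max z1 z1'.
by rewrite (leq_trans (size_polyD _ _))// geq_max z2 z2'.
Qed.

Lemma wlt_sum w (I : Type) (r : seq I) (p : pred I) (F : I -> QA) :
  (forall i, p i -> wlt w (F i)) -> wlt w (\sum_(i <- r | p i) F i).
Proof. by move=> wF; elim/big_ind: _ => //; [exact: wlt0|exact: wltD]. Qed.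

Lemma wlt_const (c : {poly E}) : wlt (size c) (qconst h a%:P c).
Proof. by rewrite /wlt /= leqnn size_poly0. Qed.

Lemma wlt_gen : wlt d.+1 (qgen h a%:P).
Proof. by rewrite /wlt /= size_poly0 size_poly1 subSnn. Qed.

Lemma size_mulh_leq w (c : {poly E}) :
  (size c <= w - d)%N -> (size (h * c)%R <= w)%N.
Proof.
have [-> _|c0 cw] := eqVneq c 0; first by rewrite mulr0 size_poly0.
have c1 : (0 < size c)%N by rewrite lt0n size_poly_eq0.
by apply: leq_trans (size_polyMleq _ _) _; rewrite size_h; lia.
Qed.

Lemma wltN w z : wlt w z -> wlt w (- z).
Proof. by rewrite /wlt /= !size_polyN. Qed.

Lemma wlt_conj w z : wlt w z -> wlt w (qconj z).
Proof.
move=> /andP[z1 z2]; rewrite /wlt /= size_polyN z2 andbT.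
by rewrite (leq_trans (size_polyD _ _))// geq_max z1 size_mulh_leq.
Qed.

(** Weights add up, x^2 = h x - a being of weight 2 d. *)
Lemma wltM v w z z' : wlt v z -> wlt w z' -> wlt (v + w).-1 (z * z').
Proof.
move=> /andP[z1 z2] /andP[z1' z2'].
have sM (f g : {poly E}) i j k : (size f <= i)%N -> (size g <= j)%N ->
    (0 < i -> 0 < j -> i + j <= k.+1)%N -> (size (f * g)%R <= k)%N.
  move=> fi gj ijk; have [->|f0] := eqVneq f 0; first by rewrite mul0r size_poly0.
  have [->|g0] := eqVneq g 0; first by rewrite mulr0 size_poly0.
  rewrite -size_poly_gt0 in f0; rewrite -size_poly_gt0 in g0.
  by apply: leq_trans (size_polyMleq _ _) _; lia.
apply/andP; split => /=.
  rewrite (leq_trans (size_polyD _ _))// geq_max size_polyN (sM _ _ v w)//=; last lia.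
  rewrite -mulrA mul_polyC size_scale// (sM _ _ (v - d)%N (w - d)%N)//; lia.
rewrite (leq_trans (size_polyD _ _))// geq_max; apply/andP; split.
  rewrite (leq_trans (size_polyD _ _))// geq_max.
  rewrite (sM _ _ v (w - d)%N)//=; last lia.
  by rewrite (sM _ _ (v - d)%N w)//=; lia.
have [->|nz2] := eqVneq z.2 0; first by rewrite mulr0 mul0r size_poly0.
have nz2' : (0 < size z.2)%N by rewrite size_poly_gt0.
rewrite (sM _ _ v (w - d)%N)//; first by apply: size_mulh_leq.
lia.
Qed.

Lemma wltX w z n : wlt w.+1 z -> wlt (w * n).+1 (z ^+ n).
Proof.
move=> wz; elim: n => [|n IHn].
  by rewrite expr0 muln0; have := wlt_const 1; rewrite size_poly1.
by rewrite exprS (wlt_leq _ (wltM wz IHn))//= mulnS; lia.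
Qed.

Lemma wltMl n w (c : {poly E}) z : (size c <= n.+1)%N -> wlt w z ->
  wlt (n + w) (qconst h a%:P c * z).
Proof. by move=> cn wz; apply: wlt_leq (wltM (wlt_leq cn (wlt_const c)) wz). Qed.

Lemma size_qtrace w z : wlt w z -> (size (qtrace z) <= w)%N.
Proof.
move=> /andP[z1 z2]; rewrite /qtrace (leq_trans (size_polyD _ _))// geq_max.
rewrite size_mulh_leq// andbT mulr2n (leq_trans (size_polyD _ _))//.
by rewrite geq_max z1.
Qed.

Lemma size_qnorm w z : wlt w z -> (size (qnorm z) <= (w + w).-1)%N.
Proof.
move=> wz; have /andP[+ _] := wltM wz (wlt_conj wz).
by rewrite -qnormE.
Qed.

(** If A^2 + hAB + aB^2 = 0 with A, B coprime, then A and B divide each other's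
  square up to a unit, so both are constant; the term hAB then dominates. *)
Lemma qnorm_eq0 (z : QA) : qnorm z = 0 -> z = 0.
Proof.
case: z => A B; rewrite /qnorm /= => nAB.
have [B0|B0] := eqVneq B 0.
  move: nAB; rewrite B0 !(mulr0, expr0n) !addr0 => /eqP.
  by rewrite expf_eq0 => /eqP ->.
exfalso; pose g := gcdp A B.
have g0 : g != 0 by rewrite gcdp_eq0 negb_and B0 orbT.
pose A' := A %/ g; pose B' := B %/ g.
have AE : A = A' * g by rewrite divpK// dvdp_gcdl.
have BE : B = B' * g by rewrite divpK// dvdp_gcdr.
have cop : coprimep A' B'.
  by rewrite coprimep_div_gcd// B0 orbT.
have n' : A' ^+ 2 + h * A' * B' + a%:P * B' ^+ 2 = 0.
  have /eqP : (A' ^+ 2 + h * A' * B' + a%:P * B' ^+ 2) * g ^+ 2 = 0.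
    by rewrite -nAB AE BE; ring.
  by rewrite mulf_eq0 expf_eq0 (negPf g0) orbF => /eqP.
have dA : A' %| 1.
  have : A' %| B' ^+ 2 * 1.
    rewrite mulr1 -(dvdpZr _ _ a_neq0) -mul_polyC.
    have -> : a%:P * B' ^+ 2 = A' * (- A' - h * B').
      by apply/eqP; rewrite -subr_eq0 -n'; apply/eqP; ring.
    exact: dvdp_mulr.
  by rewrite Gauss_dvdpr// coprimep_expr.
have dB : B' %| 1.
  have : B' %| A' ^+ 2 * 1.
    rewrite mulr1.
    have -> : A' ^+ 2 = B' * (- h * A' - a%:P * B').
      by apply/eqP; rewrite -subr_eq0 -n'; apply/eqP; ring.
    exact: dvdp_mulr.
  by rewrite Gauss_dvdpr// coprimep_expr// coprimep_sym.
move: dA dB; rewrite !dvdp1 => sA sB.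
have sC (f k : {poly E}) : size f == 1 -> size k == 1 -> size (f * k)%R = 1%N.
  move=> /eqP f1 /eqP g1; rewrite size_mul ?f1 ?g1// -size_poly_gt0 ?f1 ?g1//.
have := congr1 (fun f : {poly E} => size f) n'.
rewrite size_poly0 addrAC addrC size_polyDl.
  rewrite -mulrA size_mul ?sC// ?size_h; last by rewrite -size_poly_gt0 sC.
    by rewrite addn1.
  by rewrite -size_poly_gt0 size_h.
rewrite -mulrA size_mul ?sC// ?size_h//; last by rewrite -size_poly_gt0 sC.
  rewrite addn1 /= ltnS (leq_trans (size_polyD _ _))// geq_max.
  by rewrite mul_polyC size_scale// !expr2 !sC// d_gt0.
by rewrite -size_poly_gt0 size_h.
Qed.

Variables (r w : nat).
Hypotheses (r_char : [pchar E].-nat r) (w_small : (w + w <= r)%N).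

(** Sums of the y^(r j) s_j, with s_j of weight less than w, play the role of
   expansions in base y^r: the bound 2 w <= r separates the digits. *)
Let Xr j : QA := qconst h a%:P 'X^(r * j).

Lemma wlt_top J (s L : QA) : wlt w s -> wlt (r * J + w - r) L ->
  wlt (r * J + w) (Xr J * s + L).
Proof.
move=> ws wL; apply: wltD; last by apply: wlt_leq wL; lia.
by apply: wltMl => //; rewrite size_polyXn.
Qed.

(** As 2 w <= r, all terms of N(y^(r J) s + L) other than y^(2 r J) N(s) have
  degree less than 2 r J. *)
Lemma size_qnorm_top J (s L : QA) : wlt w s -> wlt (r * J + w - r) L ->
  ((r * J).*2 < size (qnorm (Xr J * s + L)%R))%N = (s != 0).
Proof.
move=> ws wL; rewrite qnormD qnormM qnorm_const -addrA.
set rest := (qtrace _ + _).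
have szr : (size rest <= (r * J).*2)%N.
  rewrite /rest; case: (posnP J) => [J0|J0].
    have -> : L = 0 by apply: wlt0_eq0; apply: wlt_leq wL; lia.
    by rewrite /qtrace /qnorm /= !(mulr0, mul0r, subr0, addr0, mul0rn, oppr0, expr0n) size_poly0.
  have rJ : (r <= r * J)%N by rewrite leq_pmulr.
  rewrite (leq_trans (size_polyD _ _))// geq_max; apply/andP; split.
    have wX : wlt (r * J + w) (Xr J * s) by apply: wltMl; rewrite ?size_polyXn.
    have := size_qtrace (wltM wX (wlt_conj wL)).
    by move/leq_trans; apply; lia.
  by apply: leq_trans (size_qnorm wL) _; lia.
have [->|s0] := eqVneq s 0.
  rewrite /qnorm /= !(mulr0, expr0n) !addr0 mulr0 add0r.
  by apply/negbTE; rewrite -leqNgt.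
have n0 : qnorm s != 0.
  by apply: contra_neq s0 => /qnorm_eq0.
have sz : size ('X^(r * J) ^+ 2 * qnorm s)%R = ((r * J).*2 + size (qnorm s))%N.
  by rewrite -exprM muln2 mulrC size_mulXn.
have lt : (size rest < size ('X^(r * J) ^+ 2 * qnorm s)%R)%N.
  by rewrite sz; apply: leq_ltn_trans szr _; rewrite -addn1 leq_add2l size_poly_gt0.
by rewrite size_polyDl// sz -addn1 leq_add2l size_poly_gt0 n0.
Qed.

(** Write S and S' for the two sums, so that S = - x^r S'. Norms give
  N(S) = a^r N(S'), hence s and s' vanish together. If they do not vanish, then
  N(S') has degree at least 2 r J, and the trace of S conj(S') = - x^r N(S') is
  - h^r N(S'), of degree at least 2 r J + r d; this is more than the weights of S
  and S' allow. *)
Lemma top_coef_eq0 J (s s' L L' : QA) :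
    wlt w s -> wlt w s' ->
    wlt (r * J + w - r) L -> wlt (r * J + w - r) L' ->
    (Xr J * s + L) + qgen h a%:P ^+ r * (Xr J * s' + L') = 0 ->
  s = 0 /\ s' = 0.
Proof.
move=> ws ws' wL wL'; set S := _ + L; set S' := _ + L' => SS'.
have SE : S = - (qgen h a%:P ^+ r * S') by apply/eqP; rewrite -subr_eq0 opprK SS'.
have NE : qnorm S = (a ^+ r)%:P * qnorm S'.
  by rewrite SE qnormN qnormM qnormX qnorm_gen rmorphXn.
have szE : size (qnorm S) = size (qnorm S').
  by rewrite NE mul_polyC size_scale// expf_neq0.
have ss' : (s == 0) = (s' == 0).
  apply: negb_inj; rewrite -(size_qnorm_top ws wL) -(size_qnorm_top ws' wL').
  by rewrite -/S -/S' szE.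
suff s'0 : s' = 0 by split=> //; apply/eqP; rewrite ss' s'0.
apply/eqP; apply: contraT => s'N0.
have szS' : ((r * J).*2 < size (qnorm S'))%N by rewrite size_qnorm_top.
have TE : qtrace (S * qconj S') = - (h ^+ r * qnorm S').
  rewrite SE mulNr -mulrA qtraceN -qnormE mulrC qtraceMl qtrace_genX 1?mulrC//.
  by apply: sub_in_pnat r_char => p _ /(rmorph_pchar (@polyC E)).
have wSS : wlt ((r * J + w) + (r * J + w)).-1 (S * qconj S').
  by apply: wltM => //; [apply: wlt_top|apply: wlt_conj => //; apply: wlt_top].
have := size_qtrace wSS; rewrite TE size_polyN.
have h0 : h != 0 by rewrite -size_poly_gt0 size_h.
have n0 : qnorm S' != 0 by rewrite -size_poly_gt0; lia.
have sh : (size (h ^+ r)%R).-1 = (d * r)%N by rewrite size_exp size_h.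
have hr0 : (0 < size (h ^+ r)%R)%N by rewrite size_poly_gt0 expf_neq0.
rewrite size_mul ?expf_neq0// => size_le; exfalso.
have rd : (r <= d * r)%N by rewrite leq_pmull.
set A := size (qnorm S') in szS' size_le.
set B := size (h ^+ r) in hr0 sh size_le.
move: A B (r * J)%N (d * r)%N hr0 sh size_le szS' rd; lia.
Qed.

(** The digits are shown to vanish one at a time, from the top. *)
Lemma frob_combination_inj l (s s' : nat -> QA) :
    (forall j, wlt w (s j)) -> (forall j, wlt w (s' j)) ->
    \sum_(j < l) Xr j * (s j + qgen h a%:P ^+ r * s' j) = 0 ->
  forall j, (j < l)%N -> s j = 0 /\ s' j = 0.
Proof.
move=> ws ws'; elim: l => [//|l IHl].
have wsum (u : nat -> QA) : (forall j, wlt w (u j)) ->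
    wlt (r * l + w - r) (\sum_(j < l) Xr j * u j).
  move=> wu; apply: wlt_sum => j _; apply: (@wlt_leq (r * j + w)).
    by have := leq_mul (leqnn r) (ltn_ord j); rewrite mulnS; lia.
  by apply: wltMl => //; rewrite size_polyXn.
rewrite big_ord_recr /= => sum0.
have [sl s'l] : s l = 0 /\ s' l = 0.
  apply: (top_coef_eq0 (ws l) (ws' l) (wsum s ws) (wsum s' ws')).
  rewrite -[RHS]sum0; under [in RHS]eq_bigr do rewrite mulrDr mulrCA.
  rewrite big_split /= -mulr_sumr; ring.
move=> j; rewrite ltnS leq_eqVlt => /orP[/eqP->//|]; apply: IHl.
by move: sum0; rewrite sl s'l mulr0 addr0 mulr0 addr0.
Qed.

End Weight.

(** * Stepanov's method *)

Section Stepanov.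
Variables (E : finFieldType) (d : nat) (h : {poly E}) (a : E).
Hypotheses (d_gt0 : (0 < d)%N) (size_h : size h = d.+1) (a_neq0 : a != 0).
Local Notation QA := (quadAlg h a%:P).
Local Notation qc := (qconst h a%:P).
Variable r : nat.
Hypotheses (r_char : [pchar E].-nat r) (card_E : #|E| = (r ^ 2)%N).

(** The ordinates above which the curve has two rational points. *)
Definition splitPoints :=
  [set y : E | [exists x1 : E, exists x2 : E,
     [&& x1 != x2, x1 ^+ 2 == h.[y] * x1 - a & x2 ^+ 2 == h.[y] * x2 - a]]].

Let quad_frobB (z z' : QA) : (z - z') ^+ r = z ^+ r - z' ^+ r.
Proof.
have rQ : [pchar QA].-nat r.
  by apply: sub_in_pnat r_char => p _ /(rmorph_pchar (@polyC E)) /(rmorph_pchar qc).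
by apply/eqP; rewrite eq_sym subr_eq -exprDn_pchar// subrK.
Qed.

(** By counting: there are 4 k l free coefficients in E for
  2 (r (k + d) + d + l) coefficient equations, and the equations are additive
  because raising to the power r is, so that the difference of two families of
  coefficients with the same image is a solution. *)
Lemma stepanov_aux k l :
    (r * (k + d) + d + l < 2 * (k * l))%N ->
  exists s s' : nat -> QA,
  [/\ forall j, wlt d (k + d) (s j), forall j, wlt d (k + d) (s' j),
      exists2 j, (j < l)%N & (s j != 0) || (s' j != 0) &
      \sum_(j < l) qc 'X^j * (s j ^+ r + qgen h a%:P * s' j ^+ r) = 0].
Proof.
move=> many; pose w := (k + d)%N; pose W := (r * w + d + l)%N.
pose D := ('rV[E]_k * 'rV[E]_k)%type.
pose dec (u : D) : QA := (rVpoly u.1, rVpoly u.2).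
pose U := {ffun 'I_l -> D * D}.
pose Z (u : U) : QA := \sum_(j < l)
   qc 'X^j * (dec (u j).1 ^+ r + qgen h a%:P * dec (u j).2 ^+ r).
have wdec u : wlt d w (dec u).
  apply/andP; rewrite /w addnK /=; split; last exact: size_poly.
  by apply: leq_trans (size_poly _ _) _; rewrite leq_addr.
have wZ u : wlt d W (Z u).
  apply: wlt_sum => // j _.
  have wr v : wlt d (r * w).+1 (dec v ^+ r).
    rewrite mulnC; apply: wltX => //; apply: wlt_leq (wdec v) => //.
  apply: (@wlt_leq _ _ _ _ _ _ _ (j + (d.+1 + (r * w).+1).-1)) => //.
    by have := ltn_ord j; rewrite /W; lia.
  apply: wltMl => //; first by rewrite size_polyXn.
  apply: wltD => //; last by apply: wltM => //; exact: wlt_gen.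
  by apply: wlt_leq (wr _) => //; lia.
have ZB u v : Z u - Z v = \sum_(j < l) qc 'X^j * ((dec (u j).1 - dec (v j).1) ^+ r
    + qgen h a%:P * (dec (u j).2 - dec (v j).2) ^+ r).
  by rewrite -sumrB; apply: eq_bigr => i _; rewrite !quad_frobB; ring.
have defW : W = (r * w + d + l)%N by [].
clearbody Z W.
(* The map to the vectors of coefficients, between finite sets. *)
pose f (u : U) : 'rV[E]_W * 'rV[E]_W := (poly_rV (Z u).1, poly_rV (Z u).2).
have /injectivePn[u [v uv fuv]] : ~~ injectiveb f.
  apply/negP => /injectiveP/leq_card; apply/negP; rewrite -ltnNge.
  rewrite card_ffun !card_prod !card_mx card_ord !mul1n -!expnD -expnM.
  rewrite ltn_exp2l; last exact: finNzRing_gt1.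
  by rewrite ?defW /w; nia.
have Zuv : Z u = Z v.
  have szZ x : (size (Z x).1 <= W)%N /\ (size (Z x).2 <= W)%N.
    have /andP[Z1 Z2] := wZ x; split; first exact: Z1.
    exact: leq_trans Z2 (leq_subr _ _).
  case: fuv => /(congr1 rVpoly) + /(congr1 rVpoly).
  have [u1 u2] := szZ u; have [v1 v2] := szZ v.
  rewrite (poly_rV_K u1) (poly_rV_K u2) (poly_rV_K v1) (poly_rV_K v2) => e1 e2.
  exact: injective_projections.
pose ext (g : 'I_l -> QA) j := if insub j is Some i then g i else 0.
have extE g (i : 'I_l) : ext g i = g i by rewrite /ext valK.
have wext g : (forall i, wlt d w (g i)) -> forall j, wlt d w (ext g j).
  by move=> wg j; rewrite /ext; case: insub => // ; exact: wlt0.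
pose s i := dec (u i).1 - dec (v i).1; pose s' i := dec (u i).2 - dec (v i).2.
have wB x y : wlt d w (dec x - dec y) by apply: wltD => //; apply: wltN.
exists (ext s), (ext s'); split.
- by apply: wext => i; apply: wB.
- by apply: wext => i; apply: wB.
- have [i uvi] : exists i, u i != v i.
    apply/existsP; apply: contraT; rewrite negb_exists => /forallP uv0.
    by case/eqP: uv; apply/ffunP => i; have /negPn/eqP := uv0 i.
  exists i => //; rewrite !extE -negb_and; apply: contra uvi.
  have dec_inj x y : dec x - dec y == 0 -> x = y.
    rewrite subr_eq0 => /eqP []; case: x y => [x1 x2] [y1 y2] /=.
    by move=> /(can_inj rVpolyK) -> /(can_inj rVpolyK) ->.
  by case/andP => /dec_inj u1 /dec_inj u2; apply/eqP/injective_projections.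
- transitivity (Z u - Z v); last by rewrite Zuv subrr.
  by rewrite ZB; apply: eq_bigr => i _; rewrite !extE.
Qed.

(** The auxiliary function is Psi = sum_j y^(r j) (s_j + x^r s'_j). At a rational
  point x^(r^2) = x and y^(r^2) = y, so that Psi^r takes there the value of the
  combination sum_j y^j (s_j^r + x s'_j^r), which is zero. If Psi = A + B x
  vanishes at two points above y, then y is a root of both A and B, whose degrees
  are about r^2 / 2. *)
Lemma card_splitPoints_aux k l : (k + d + (k + d) <= r)%N ->
  (r * (k + d) + d + l < 2 * (k * l))%N ->
  (#|splitPoints| <= k + d + r * (d + l))%N.
Proof.
move=> w_small /stepanov_aux[s [s' [ws ws' [j0 j0l sj0] Z0]]].
set w := (k + d)%N in ws ws' w_small *.
pose Psi := \sum_(j < l) qc 'X^(r * j) * (s j + qgen h a%:P ^+ r * s' j).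
have PsiN0 : Psi != 0.
  apply: contraL sj0 => /eqP Psi0.
  have [-> ->] := frob_combination_inj d_gt0 size_h a_neq0 r_char w_small ws ws' Psi0 j0l.
  by rewrite eqxx.
have r_gt0 : (0 < r)%N by case/andP: r_char.
have wPsi : wlt d (w + r * (d + l)).+1 Psi.
  apply: wlt_sum => // j _.
  apply: (@wlt_leq _ _ _ _ _ _ _ (r * j + ((d * r).+1 + w).-1)) => //.
    have := leq_mul (leqnn r) (ltn_ord j); rewrite mulnS mulnDr [(d * r)%N]mulnC.
    by lia.
  apply: wltMl => //; first by rewrite size_polyXn.
  apply: wltD => //; first by apply: wlt_leq (ws j) => //; lia.
  by apply: wltM => //; apply: wltX => //; exact: wlt_gen.
have vanish x y : x ^+ 2 = h.[y] * x - a -> Psi.1.[y] + Psi.2.[y] * x = 0.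
  move=> xy; pose ev := @qeval _ h a%:P _ (horner_eval y) x.
  have root_x : x ^+ 2 = horner_eval y h * x - horner_eval y a%:P.
    by rewrite /= /horner_eval hornerC.
  have frobE (b : E) : b ^+ r ^+ r = b by rewrite -exprM mulnn -card_E expf_card.
  have E_frobD : {morph (fun b : E => b ^+ r) : b c / b + c}.
    by move=> b c; rewrite exprDn_pchar.
  have ev_add : {morph ev : z z' / z + z'} by exact: qeval_add.
  have evM : {morph ev : z z' / z * z'} by exact: qevalM.
  have ev0 : ev 0 = 0 by rewrite /ev /qeval /= !raddf0 mul0r addr0.
  have evX z n : ev (z ^+ n) = ev z ^+ n by exact: qevalX.
  have evqX n : ev (qc 'X^n) = y ^+ n.
    by rewrite /ev qeval_const /= /horner_eval hornerXn.
  have evgen : ev (qgen h a%:P) = x by exact: qeval_gen.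
  have : ev Psi ^+ r = 0.
    have r0 : (0 : E) ^+ r = 0 by rewrite expr0n gtn_eqF.
    rewrite -[RHS]ev0 -Z0 !(big_morph ev ev_add ev0) (big_morph _ E_frobD r0); apply: eq_bigr => j _.
    rewrite !(evM, ev_add, evX, evqX, evgen) exprMn E_frobD exprMn frobE.
    by rewrite exprM exprAC frobE.
  by move/eqP; rewrite expf_eq0 r_gt0 /= => /eqP.
have vanish2 y : y \in splitPoints -> Psi.1.[y] = 0 /\ Psi.2.[y] = 0.
  rewrite inE => /existsP[x1 /existsP[x2 /and3P[x12 /eqP/vanish v1 /eqP/vanish v2]]].
  have P2 : Psi.2.[y] = 0.
    have /eqP : Psi.2.[y] * (x1 - x2) = 0 by rewrite -(subrr 0) -{1}v1 -v2; ring.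
    by rewrite mulf_eq0 subr_eq0 (negPf x12) orbF => /eqP.
  by move: v1; rewrite P2 mul0r addr0.
have root_bound (f : {poly E}) : f != 0 -> (size f <= (w + r * (d + l)).+1)%N ->
    (forall y, y \in splitPoints -> f.[y] = 0) ->
    (#|splitPoints| <= w + r * (d + l))%N.
  move=> f0 szf rootf; rewrite -ltnS (leq_trans _ szf)// cardE.
  apply: max_poly_roots f0 _ (enum_uniq _).
  by apply/allP => y; rewrite mem_enum => /rootf/rootP.
have /andP[sz1 sz2] := wPsi.
have [P1|P1] := eqVneq Psi.1 0; last first.
  by apply: (root_bound _ P1 sz1) => y /vanish2[].
have P2 : Psi.2 != 0.
  by apply: contraNneq PsiN0 => P2; rewrite [Psi]surjective_pairing P1 P2.
apply: (root_bound _ P2) => [|y /vanish2[]//].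
by apply: leq_trans sz2 _; rewrite leq_subr.
Qed.

(** With k about r / 4 and l about r / 2, up to a multiple of d that makes the
  coefficients outnumber the equations. *)
Lemma card_splitPoints : (4 * d <= r)%N -> (8 <= r)%N ->
  (2 * #|splitPoints| <= r ^ 2 + (10 * d + 26) * r)%N.
Proof.
move=> rd r8; pose k := (r %/ 4)%N; pose c := (4 * d + 12)%N.
pose l := (r %/ 2 + c)%N.
have [k1 k2] : (4 * k <= r)%N /\ (r <= 8 * k)%N by rewrite /k; lia.
have [l1 l2] : (2 * l <= r + 2 * c)%N /\ (r + 2 * c <= 2 * l + 1)%N by rewrite /l; lia.
have small : (k + d + (k + d) <= r)%N by lia.
have : (r * (k + d) + d + l < 2 * (k * l))%N.
  have h1 : (k * (r + 2 * c) <= k * (2 * l + 1))%N by rewrite leq_mul.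
  have h2 : (r * (8 * d + 23) <= 8 * k * (8 * d + 23))%N by rewrite leq_mul.
  rewrite /c in h1 l1.
  nia.
move=> /(card_splitPoints_aux small) nle.
have h3 : (r * (2 * (d + l)) <= r * (2 * d + (r + 2 * c)))%N by rewrite leq_mul//; lia.
rewrite /c in h3.
nia.
Qed.

End Stepanov.

(** * Kloosterman sums over a field of square order *)

Definition isAddChar (C : numClosedFieldType) (F : finFieldType) (psi : F -> C) :=
  [/\ {morph psi : x y / x + y >-> x * y}, forall x, `|psi x| = 1
    & exists x, psi x != 1].

Definition kloos1 (C : numClosedFieldType) (F : finFieldType) (psi : F -> C)
    (a : F) : C :=
  \sum_(x | x != 0) psi (x + a / x).

Section AddChar.
Variables (C : numClosedFieldType) (F : finFieldType) (psi : F -> C).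
Hypothesis psiP : isAddChar psi.

Lemma addcharD x y : psi (x + y) = psi x * psi y.
Proof. by case: psiP. Qed.

Lemma addchar_norm x : `|psi x| = 1.
Proof. by case: psiP. Qed.

Lemma addchar_neq0 x : psi x != 0.
Proof. by rewrite -normr_eq0 addchar_norm oner_eq0. Qed.

Lemma addchar0 : psi 0 = 1.
Proof. by apply: (mulfI (addchar_neq0 0)); rewrite -addcharD addr0 mulr1. Qed.

Lemma addcharN x : psi (- x) = (psi x)^-1.
Proof.
apply: (mulfI (addchar_neq0 x)).
by rewrite -addcharD subrr addchar0 divff// addchar_neq0.
Qed.

Lemma addchar_conj x : Num.conj (psi x) = psi (- x).
Proof.
apply: (mulfI (addchar_neq0 x)).
by rewrite -normCK addchar_norm expr1n -addcharD subrr addchar0.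
Qed.

Lemma sum_addchar (c : F) :
  \sum_x psi (c * x) = if c == 0 then #|F|%:R else 0.
Proof.
have [->|c0] := eqVneq c 0.
  by under eq_bigr do rewrite mul0r addchar0; rewrite sumr_const.
have [_ _ [z psiz]] := psiP.
apply/eqP; have /eqP : (psi z - 1) * \sum_x psi (c * x) = 0.
  rewrite mulrBl mul1r mulr_sumr (reindex_inj (addrI (- (z / c)))) /=.
  rewrite -sumrB big1// => x _.
  by rewrite -addcharD mulrDr mulrN mulrCA divff// mulr1 addrA subrr add0r subrr.
by rewrite mulf_eq0 subr_eq0 (negPf psiz).
Qed.

Lemma sum_addchar1 : \sum_x psi x = 0.
Proof.
by have := sum_addchar 1; rewrite oner_eq0; under eq_bigr do rewrite mul1r.
Qed.

End AddChar.

(** For y outside the split points, X^2 - h(y) X + a has at most one root in E,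
  and if it has one then its discriminant vanishes. *)
Lemma card_kloos_fiber (E : finFieldType) (h : {poly E}) (a : E) (y : E) : a != 0 ->
  (#|[set x : E | (x != 0%R) && (x + a / x == h.[y])%R]|
    <= (y \in splitPoints h a) * 2 + root (h ^+ 2 - (a *+ 4)%:P)%R y)%N.
Proof.
move=> a0; set A := [set x | _].
have AP x : x \in A -> x ^+ 2 = h.[y] * x - a.
  by rewrite inE => /andP[x0 /eqP <-]; rewrite mulrDl divfK// addrK.
have [->|[x1 x1A]] := set_0Vmem A; first by rewrite cards0.
have e1 := AP _ x1A.
have sA : A \subset [set x1; h.[y] - x1].
  apply/fintype.subsetP => x /AP e; rewrite !inE.
  rewrite -subr_eq0 -[x == _ - _]subr_eq0 -mulf_eq0; apply/eqP.
  have -> : (x - x1) * (x - (h.[y] - x1)) = x ^+ 2 - x1 ^+ 2 - h.[y] * (x - x1).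
    by ring.
  by rewrite e e1; ring.
have [x1d|x1d] := eqVneq x1 (h.[y] - x1).
  have hy : h.[y] = x1 *+ 2 by rewrite mulr2n -[LHS](subrK x1) -x1d.
  rewrite (leq_trans (subset_leq_card sA))// -x1d finset.setUid cards1.
  have a1 : a = x1 ^+ 2.
    apply/eqP; rewrite -subr_eq0; apply/eqP.
    have -> : a - x1 ^+ 2 = (h.[y] * x1 - x1 ^+ 2 *+ 2) - (h.[y] * x1 - a - x1 ^+ 2).
      by ring.
    by rewrite -e1 subrr hy; ring.
  have -> : root (h ^+ 2 - (a *+ 4)%:P) y.
    by apply/rootP; rewrite hornerD hornerN hornerC horner_exp hy a1; ring.
  by rewrite addn1.
have -> : y \in splitPoints h a.
  rewrite inE; apply/existsP; exists x1; apply/existsP; exists (h.[y] - x1).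
  rewrite x1d {1}e1 eqxx /= sqrrB e1; apply/eqP.
  by ring: e1.
rewrite mul1n (leq_trans (subset_leq_card sA))// (leq_trans (_ : _ <= 2)%N) ?leq_addr//.
by rewrite cards2; case: (_ != _).
Qed.

Section SquareOrder.
Variables (C : numClosedFieldType) (E : finFieldType) (chi : E -> C) (a : E).
Variables (q r : nat).
Hypotheses (chiP : isAddChar chi) (chi_q : forall y, chi (y ^+ q) = chi y).
Hypotheses (a_neq0 : a != 0) (q_gt1 : (1 < q)%N).
Hypotheses (r_char : [pchar E].-nat r) (card_E : #|E| = (r ^ 2)%N).
Hypotheses (r_large : (4 * q <= r)%N) (r_ge8 : (8 <= r)%N).

(** Points of the curve x + a / x = b + y^q - y. *)
Let n b := (\sum_(y : E) #|[set x : E | (x != 0%R) && (x + a / x == b + y ^+ q - y)%R]|)%N.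

(** The 2 #|splitPoints| points are r^2 + O(q r) by Stepanov's method, and at most
  2 q values of y are zeros of the discriminant. *)
Lemma card_artin_schreier b : (n b <= r ^ 2 + (12 * q + 26) * r)%N.
Proof.
pose h : {poly E} := 'X^q - 'X + b%:P.
have size_h : size h = q.+1.
  rewrite /h -addrA size_polyDl size_polyXn// ltnS.
  rewrite (leq_trans (size_polyD _ _))// geq_max size_polyN size_polyX q_gt1.
  by rewrite (leq_trans (size_polyC_leq1 _))// ltnW.
have q_gt0 : (0 < q)%N by apply: ltnW.
have hE y : h.[y] = b + y ^+ q - y.
  by rewrite /h !hornerE; ring.
pose g := h ^+ 2 - (a *+ 4)%:P.
have szh2 : size (h ^+ 2)%R = (2 * q).+1.
  have h2_gt0 : (0 < size (h ^+ 2)%R)%N.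
    by rewrite size_poly_gt0 expf_neq0// -size_poly_gt0 size_h.
  by rewrite -(prednK h2_gt0) size_exp size_h mulnC.
have szg : size g = (2 * q).+1.
  rewrite /g size_polyDl szh2// size_polyN (leq_ltn_trans (size_polyC_leq1 _))//.
  by lia.
have card_g : (#|[set y | root g y]| <= 2 * q)%N.
  have g0 : g != 0 by rewrite -size_poly_gt0 szg.
  rewrite -ltnS -szg cardE; apply: max_poly_roots g0 _ (enum_uniq _).
  by apply/allP => y; rewrite mem_enum inE.
have nb : (n b <= 2 * #|splitPoints h a| + #|[set y | root g y]|)%N.
  have cardS (A : {set E}) : #|A| = (\sum_y (y \in A))%N.
    by rewrite -sum1_card big_mkcond; apply: eq_bigr => y _; case: (y \in A).
  rewrite (cardS (splitPoints _ _)) (cardS [set y | _]) mulnC big_distrl -big_split.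
  apply: leq_sum => y _; rewrite -hE /=.
  have -> : (y \in [set z | root g z]) = root g y by rewrite inE.
  by apply: leq_trans (card_kloos_fiber h y a_neq0) _; rewrite leqnn.
have := card_splitPoints q_gt0 size_h a_neq0 r_char card_E r_large r_ge8.
move: nb card_g; set u := #|_|; set v := #|_|; nia.
Qed.

(** As chi is trivial on the differences y^q - y, it takes the value chi b at
  x + a / x for all points counted by n b. *)
Lemma kloos1_artin_schreier :
  #|E|%:R * kloos1 chi a = \sum_b chi b * (n b)%:R.
Proof.
transitivity (\sum_(x | x != 0) \sum_y chi (x + a / x - (y ^+ q - y))).
  rewrite /kloos1 mulr_sumr; apply: eq_bigr => x _.
  transitivity (\sum_(y : E) chi (x + a / x)).
    by rewrite mulr_natl sumr_const.
  apply: eq_bigr => y _; rewrite [RHS](addcharD chiP) (addcharN chiP).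
  rewrite (addcharD chiP (y ^+ q)) (addcharN chiP) chi_q.
  by rewrite divff ?addchar_neq0// invr1 mulr1.
rewrite exchange_big /=.
transitivity (\sum_b \sum_y \sum_(x | (x != 0) && (x + a / x == b + y ^+ q - y)) chi b).
  rewrite [RHS]exchange_big /=; apply: eq_bigr => y _.
  rewrite [RHS](exchange_big_dep (fun x => x != 0))/=; last by move=> b x _ /andP[].
  apply: eq_bigr => x x0; rewrite (big_pred1 (x + a / x - (y ^+ q - y)))// => b /=.
  by rewrite x0 /= -addrA -subr_eq eq_sym.
apply: eq_bigr => b _; rewrite /n natr_sum mulr_sumr; apply: eq_bigr => y _.
rewrite -sum1_card natr_sum mulr_sumr; apply: eq_big => [x|x _]; first by rewrite inE.
by rewrite mulr1.
Qed.

(** All n b are at most M = r^2 + O(q r), while their sum is r^2 (r^2 - 1): their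
  defects M - n b add up to O(q r^3). Since the sum of chi vanishes, n b may be
  replaced with its defect in the formula for r^2 kloos1. *)
Lemma kloos1_square_order : `|kloos1 chi a| <= ((12 * q + 27) * r)%:R.
Proof.
pose M := (r ^ 2 + (12 * q + 26) * r)%N.
have Q_gt0 : 0 < #|E|%:R :> C by rewrite ltr0n; apply/card_gt0P; exists 0.
rewrite -(ler_pM2l Q_gt0) -[X in X * `|_|]ger0_norm ?ler0n// -normrM.
rewrite kloos1_artin_schreier.
have -> : \sum_b chi b * (n b)%:R = - \sum_b chi b * (M%:R - (n b)%:R).
  under [in RHS]eq_bigr do rewrite mulrBr.
  by rewrite sumrB -mulr_suml (sum_addchar1 chiP) mul0r sub0r opprK.
rewrite normrN (le_trans (ler_norm_sum _ _ _))//.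
have -> : \sum_b `|chi b * (M%:R - (n b)%:R)| = \sum_b (M%:R - (n b)%:R).
  apply: eq_bigr => b _; rewrite normrM addchar_norm// mul1r ger0_norm//.
  by rewrite subr_ge0 ler_nat card_artin_schreier.
have sum_n : (\sum_b n b = #|E| * #|E|.-1)%N.
  rewrite exchange_big /= -sum_nat_const; apply: eq_bigr => y _.
  under eq_bigr do rewrite -sum1_card.
  rewrite (exchange_big_dep (fun x => x != 0))/=; last by move=> b x _; rewrite inE => /andP[].
  rewrite -(cardC1 (0 : E)) -sum1_card; apply: eq_big => x //= x0.
  rewrite (big_pred1 (x + a / x - (y ^+ q - y)))// => b /=.
  by rewrite inE x0 /= -addrA -subr_eq eq_sym.
have card_le : (#|E|.-1 <= M)%N.
  by rewrite /M card_E (leq_trans (leq_pred _))// leq_addr.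
rewrite sumrB -[X in _ - X]natr_sum sum_n sumr_const -mulrnA [(M * _)%N]mulnC.
rewrite -natrB ?leq_mul// -natrM ler_nat -mulnBr leq_mul// /M card_E.
by nia.
Qed.

End SquareOrder.

(** * Kloosterman sums in a quadratic extension *)

Lemma card_pnat (F : finFieldType) : [pchar F].-nat #|F|.
Proof.
have [p p_pr pF] := finPcharP F.
by rewrite (card_pprimeChar pF) pnatX pnatE// pF.
Qed.

(** The map (x, y) -> (x + y, xy) is not injective, hence not onto: some
  X^2 - sX + t has no root. *)
Lemma quadratic_extension (F : finFieldType) :
  exists (E : finFieldType) (iota : {rmorphism F -> E}), #|E| = (#|F| ^ 2)%N.
Proof.
pose g (u : F * F) := (u.1 + u.2, u.1 * u.2).
have [[s t] st] : exists st, st \notin codom g.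
  apply/existsP; rewrite -[X in is_true X]negbK negb_exists; apply/negP => /forallP onto.
  have /injectiveP g_inj : injectiveb g.
    rewrite /injectiveb /dinjectiveb; apply/card_uniqP.
    rewrite size_map -cardE; apply: eq_card => u.
    by have /negPn -> := onto u.
  have /g_inj[/esym/eqP] : g (0, 1) = g (1, 0) by rewrite /g /= mulr0 mul0r addrC.
  by rewrite oner_eq0.
pose h : {poly F} := 'X^2 - s *: 'X + t%:P.
have szlow : (size (- (s *: 'X) + t%:P)%R <= 2)%N.
  rewrite (leq_trans (size_polyD _ _))// geq_max size_polyN.
  rewrite (leq_trans (size_scale_leq _ _)) ?size_polyX//=.
  by rewrite (leq_trans (size_polyC_leq1 _)).
have size_h : size h = 3.
  by rewrite /h -addrA size_polyDl size_polyXn.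
have hI : monic_irreducible_poly h.
  split.
    apply: cubic_irreducible => [|x]; first by rewrite size_h.
    apply: contra st => /rootP hx.
    apply/codomP; exists (x, s - x); rewrite /g /=; congr (_, _); first by ring.
    move: hx; rewrite /h !hornerE => hx.
    by apply/eqP; rewrite -subr_eq0 -hx; apply/eqP; ring.
  apply/monicP; rewrite /h -addrA lead_coefDl ?size_polyXn ?ltnS//.
  exact: lead_coefXn.
exists {poly %/ h with hI}, (in_alg {poly %/ h with hI}).
by rewrite card_qfpoly size_h.
Qed.

Section QuadraticExtension.
Variables (F E : finFieldType) (iota : {rmorphism F -> E}).
Hypothesis card_E : #|E| = (#|F| ^ 2)%N.
Local Notation q := #|F|.

Let frobD : {morph (fun z : E => z ^+ q) : z w / z + w}.
Proof.
move=> z w; rewrite exprDn_pchar//.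
by apply: sub_in_pnat (card_pnat F) => p _ /(rmorph_pchar iota).
Qed.

Let frob_iota x : iota x ^+ q = iota x.
Proof. by rewrite -rmorphXn expf_card. Qed.

Let frobK (z : E) : z ^+ q ^+ q = z.
Proof. by rewrite -exprM mulnn -card_E expf_card. Qed.

(** X^q - X has no other roots than the q elements of the image of F. *)
Lemma fixed_iota (z : E) : z ^+ q = z -> exists x, iota x = z.
Proof.
move=> zq; apply/not_existsP => nz.
pose f : {poly E} := 'X^q - 'X.
have q_gt1 : (1 < q)%N by exact: finNzRing_gt1.
have szf : size f = q.+1.
  by rewrite /f size_polyDl size_polyXn// size_polyN size_polyX.
have f0 : f != 0 by rewrite -size_poly_gt0 szf.
have : (size (z :: map iota (enum F)) < size f)%N.
  apply: max_poly_roots f0 _ _.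
    apply/allP => y; rewrite inE => /orP[/eqP->|/mapP[x _ ->]];
      by apply/rootP; rewrite !hornerE ?frob_iota ?zq subrr.
  rewrite /= map_inj_uniq ?enum_uniq ?andbT; last exact: fmorph_inj.
  by apply/mapP => -[x _ e]; apply: (nz x).
by rewrite /= size_map -cardE szf ltnn.
Qed.

Lemma relative_trace : exists tau : E -> F, forall z, iota (tau z) = z + z ^+ q.
Proof.
have /boolp.choice[tau tauE] : forall z : E, exists x, iota x = z + z ^+ q.
  by move=> z; apply: fixed_iota; rewrite frobD frobK addrC.
by exists tau.
Qed.

Lemma relative_norm : exists nu : E -> F, forall z, iota (nu z) = z * z ^+ q.
Proof.
have /boolp.choice[nu nuE] : forall z : E, exists x, iota x = z * z ^+ q.
  by move=> z; apply: fixed_iota; rewrite exprMn frobK mulrC.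
by exists nu.
Qed.

Variables (tau nu : E -> F).
Hypotheses (tauE : forall z, iota (tau z) = z + z ^+ q).
Hypotheses (nuE : forall z, iota (nu z) = z * z ^+ q).

Let symF (u : F * F) := (u.1 + u.2, u.1 * u.2).
Let symE (z : E) := (tau z, nu z).

Let root_symE z (u : F * F) : symE z = symF u -> (z == iota u.1) || (z == iota u.2).
Proof.
move=> [zt zn]; rewrite -subr_eq0 -[z == iota u.2]subr_eq0 -mulf_eq0; apply/eqP.
have -> : (z - iota u.1) * (z - iota u.2) = z ^+ 2 - z * iota (u.1 + u.2) + iota (u.1 * u.2).
  by rewrite rmorphD rmorphM; ring.
by rewrite -zt -zn tauE nuE; ring.
Qed.

(** If X^2 - sX + t has a root in F, then it splits there, and the z above (s, t)
  are among its roots; such a z is fixed by Frobenius, which forces a double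
  root. *)
Lemma card_sym_leq st :
  (#|[set u | symF u == st]| + #|[set z | symE z == st]| <= 2)%N.
Proof.
set A := [set u | _]; set B := [set z | _].
have [A0|[[x y]]] := set_0Vmem A.
  rewrite A0 cards0 add0n.
  have [->|[z0 z0B]] := set_0Vmem B; first by rewrite cards0.
  have BE z : z \in B -> z ^+ 2 = z * iota st.1 - iota st.2.
    by rewrite inE => /eqP <- /=; rewrite tauE nuE; ring.
  have sB : B \subset [set z0; iota st.1 - z0].
    apply/fintype.subsetP => z /BE e; have e0 := BE _ z0B; rewrite !inE.
    rewrite -subr_eq0 -[z == _ - _]subr_eq0 -mulf_eq0; apply/eqP.
    have -> : (z - z0) * (z - (iota st.1 - z0)) = z ^+ 2 - z0 ^+ 2 - iota st.1 * (z - z0).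
      by ring.
    by rewrite e e0; ring.
  by rewrite (leq_trans (subset_leq_card sB))// cards2; case: (_ != _).
rewrite inE => /eqP stE.
have sA : A \subset [set (x, y); (y, x)].
  apply/fintype.subsetP => -[x' y']; rewrite !inE -stE => /eqP[es ep].
  have /eqP : (x' - x) * (x' - y) = 0.
    have -> : (x' - x) * (x' - y) = x' ^+ 2 - x' * (x + y) + x * y by ring.
    by rewrite -es -ep; ring.
  rewrite mulf_eq0 !subr_eq0 => /orP[] /eqP e; rewrite e in es ep *.
    by have -> : y' = y; [apply: (addrI x)|rewrite eqxx].
  by have -> : y' = x; [apply: (addrI y); rewrite es addrC|rewrite eqxx orbT].
have Bxy z : z \in B -> z = iota x /\ x = y.
  rewrite inE -stE => /eqP ze.
  have zq : z ^+ q = z.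
    by have := root_symE ze => /= /orP[] /eqP ->; rewrite frob_iota.
  have zz : z + z = iota x + iota y.
    by rewrite -rmorphD -[X in _ + X]zq -tauE; case: ze => ->.
  have := root_symE ze => /= /orP[] /eqP e; rewrite e in zz *; split => //.
  - by apply: (fmorph_inj iota); apply: addrI zz.
  - by apply: addIr zz.
  - by apply: esym; apply: (fmorph_inj iota); apply: addIr zz.
have [xy|xy] := eqVneq x y.
  have sB : B \subset [set iota x].
    by apply/fintype.subsetP => z /Bxy[-> _]; rewrite inE.
  rewrite (leq_trans (leq_add (subset_leq_card sA) (subset_leq_card sB)))//.
  by rewrite xy finset.setUid !cards1.
have -> : B = finset.set0.
  apply/finset.setP => z; rewrite [in RHS]inE; apply/negP => /Bxy[_ e].
  by rewrite e eqxx in xy.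
rewrite cards0 addn0 (leq_trans (subset_leq_card sA))// cards2.
by case: (_ != _).
Qed.

(** X^2 - sX + t has two roots, either both in F or conjugate in E. Given the upper
  bound, it is enough that equality holds on average: there are q^2 pairs (x, y),
  q^2 elements z and q^2 values of (s, t). *)
Lemma card_sym st :
  (#|[set u | symF u == st]| + #|[set z | symE z == st]| = 2)%N.
Proof.
have sum_fibre (T : finType) (f : T -> F * F) :
    (\sum_st #|[set u | f u == st]| = #|T|)%N.
  rewrite -sum1_card (partition_big f xpredT)//=; apply: eq_bigr => w _.
  by rewrite -sum1_card; apply: eq_bigl => u; rewrite inE.
have : (\sum_st (2 - (#|[set u | symF u == st]| + #|[set z | symE z == st]|)) = 0)%N.
  rewrite sumnB; last by move=> w _; apply: card_sym_leq.
  rewrite big_split /= !sum_fibre sum_nat_const card_prod card_E.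
  by rewrite mulnn addnn muln2 subnn.
move/eqP; rewrite sum_nat_eq0 => /forallP/(_ st) /=.
by rewrite subn_eq0 => le2; apply/eqP; rewrite eqn_leq card_sym_leq.
Qed.

Variables (C : numClosedFieldType) (psi : F -> C) (a : F).
Hypotheses (psiP : isAddChar psi) (a_neq0 : a != 0).

Lemma tau_add : {morph tau : z w / z + w}.
Proof.
move=> z w; apply: (fmorph_inj iota).
by rewrite rmorphD !tauE frobD; ring.
Qed.

(** The trace is F-linear; if it vanished, then z^q = -z for all z, and 1 = -1
  would make every element of E fixed by Frobenius. *)
Lemma addchar_trace : isAddChar (psi \o tau).
Proof.
split.
- by move=> z w; rewrite /= tau_add (addcharD psiP).
- by move=> z; rewrite /= (addchar_norm psiP).
have tauZ x z : tau (iota x * z) = x * tau z.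
  apply: (fmorph_inj iota); rewrite rmorphM !tauE exprMn frob_iota; ring.
have [z0 tz0] : exists z, tau z != 0.
  apply/not_existsP => tz.
  have fE (z : E) : z ^+ q = - z.
    apply/eqP; rewrite -addr_eq0 addrC -tauE; have := tz z.
    by move/negP/negPn/eqP => ->; rewrite rmorph0.
  have one : (1 : E) = -1 by rewrite -(fE 1) expr1n.
  have zq (z : E) : z ^+ q = z by rewrite fE -[z]mulr1 -mulrN -one.
  have sub : [set: E] \subset [set iota x | x in F].
    apply/fintype.subsetP => z _; have [x <-] := fixed_iota (zq z).
    exact: imset_f.
  have := leq_trans (subset_leq_card sub) (leq_imset_card _ _).
  rewrite cardsT card_E; apply/negP; rewrite -ltnNge -mulnn ltn_Pmulr//.
    exact: finNzRing_gt1.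
  by apply: ltnW; exact: finNzRing_gt1.
have [_ _ [x psix]] := psiP.
by exists (iota (x / tau z0) * z0); rewrite /= tauZ divfK.
Qed.

(** Both kloos1 psi a ^+ 2 and the sum over E are sums of psi (s + a s / t), over
  the pairs (x, y) with x + y = s and xy = t and over the z with trace s and norm
  t. Together they cover every (s, t) twice, and the sum over s vanishes unless
  t = -a. *)
Lemma kloos1_quadratic :
  kloos1 (psi \o tau) (iota a) = (2 * q)%:R - kloos1 psi a ^+ 2.
Proof.
pose G (st : F * F) := psi (st.1 + a * st.1 / st.2).
have sum_fibre (T : finType) (f : T -> F * F) :
    \sum_(u | (f u).2 != 0) G (f u) =
    \sum_(st | st.2 != 0) #|[set u | f u == st]|%:R * G st.
  rewrite (partition_big f (fun st => st.2 != 0))//=; apply: eq_bigr => st st0.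
  rewrite (eq_big (fun u => u \in [set u | f u == st]) (fun=> G st)).
  - by rewrite sumr_const mulr_natl.
  - by move=> u; rewrite inE andb_idl// => /eqP ->.
  - by move=> u /andP[_ /eqP ->].
have KF : kloos1 psi a ^+ 2 = \sum_(u | (symF u).2 != 0) G (symF u).
  rewrite expr2 /kloos1 big_distrlr /= pair_big /=; apply: eq_big => [[x y]|[x y]] /=.
    by rewrite mulf_eq0 negb_or.
  move=> /andP[x0 y0]; rewrite -(addcharD psiP) /G /=; congr psi.
  by field; rewrite x0 y0.
have nu0 z : (nu z == 0) = (z == 0).
  rewrite -(fmorph_eq0 iota) nuE -exprS expf_eq0//.
have KE : kloos1 (psi \o tau) (iota a) = \sum_(z | (symE z).2 != 0) G (symE z).
  rewrite /kloos1; apply: eq_big => [z|z z0] /=; first by rewrite nu0.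
  rewrite /G /=; congr psi; apply: (fmorph_inj iota).
  rewrite !(rmorphD, rmorphM, fmorphV) /= !tauE nuE frobD exprMn exprVn frob_iota.
  by field; rewrite z0 expf_neq0.
apply/eqP; rewrite -subr_eq opprK KE KF !sum_fibre -big_split /=; apply/eqP.
transitivity (\sum_(st : F * F | st.2 != 0) 2 * G st).
  apply: eq_bigr => st _; rewrite -mulrDl -natrD addnC card_sym//.
rewrite -mulr_sumr natrM; congr (_ * _).
rewrite -(pair_big xpredT (fun t => t != 0) (fun s t => G (s, t))) /= exchange_big /=.
transitivity (\sum_(t | t != 0) if t == - a then q%:R else 0 : C).
  apply: eq_bigr => t t0.
  transitivity (\sum_s psi ((1 + a / t) * s)).
    by apply: eq_bigr => s _; rewrite /G /=; congr psi; ring.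
  rewrite sum_addchar//; congr (if _ then _ else _).
  by rewrite -(inj_eq (mulIf t0)) mul0r mulrDl divfK// mul1r addr_eq0.
rewrite -big_mkcondr /= (big_pred1 (- a))// => t /=.
by case: (eqVneq t (- a)) => [->|_]; rewrite ?oppr_eq0 ?a_neq0 ?andbF.
Qed.

End QuadraticExtension.

(** * The Weil bound *)

(** If |K|^2 >= (2 + f)^2 S^2 with S^2 = #|E|, then the next sum 2 #|E| - K^2 has
  norm at least (2 + f)^2 S^2 - 2 S^2 >= (2 + 4 f) S^2. *)
Lemma kloos1_tower (C : numClosedFieldType) (F : finFieldType) (psi : F -> C)
    (a : F) (s e : C) (m : nat) :
    isAddChar psi -> a != 0 -> 0 <= s -> s ^+ 2 = #|F|%:R -> 0 <= e ->
    (2 + e) * s <= `|kloos1 psi a| ->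
  exists (E : finFieldType) (chi : E -> C) (b : E),
    [/\ #|E| = (#|F| ^ (2 ^ m))%N, isAddChar chi, b != 0,
        forall y, chi (y ^+ #|F|) = chi y
      & (2 + 4 ^+ m * e) * s ^+ (2 ^ m) <= `|kloos1 chi b|].
Proof.
move=> psiP a0 s0 s2 e0 large.
elim: m => [|m [E [chi [b [cardE chiP b0 chi_q growth]]]]].
  exists F, psi, a; rewrite !expr0 !expn0 expn1 expr1 mul1r; split=> //.
  by move=> y; rewrite expf_card.
have [E' [iota cardE']] := quadratic_extension E.
have [tau tauE] := relative_trace iota cardE'.
have [nu nuE] := relative_norm iota cardE'.
have sS : s ^+ (2 ^ m) ^+ 2 = #|E|%:R.
  by rewrite exprAC s2 cardE natrX.
exists E', (chi \o tau), (iota b); split.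
- by rewrite cardE' cardE -expnM expnSr.
- exact: addchar_trace.
- by rewrite fmorph_eq0.
- move=> y; rewrite /= -[RHS]chi_q; congr chi; apply: (fmorph_inj iota).
  rewrite tauE rmorphXn tauE /= exprAC.
  rewrite [RHS]exprDn_pchar//.
  apply: sub_in_pnat (_ : [pchar E].-nat #|F|) => [p _ /(rmorph_pchar iota)//|].
  have := card_pnat E; rewrite cardE pnatX => /orP[//|].
  by rewrite expn_eq0.
rewrite (kloos1_quadratic cardE' tauE nuE chiP b0).
set K := kloos1 chi b in growth *; set S := s ^+ (2 ^ m) in sS growth *.
have S0 : 0 <= S by rewrite exprn_ge0.
set f := 4 ^+ m * e in growth; have f0 : 0 <= f by rewrite mulr_ge0// exprn_ge0.
have K2 : ((2 + f) * S) ^+ 2 <= `|K| ^+ 2.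
  by rewrite lerXn2r ?nnegrE ?normr_ge0// mulr_ge0// addr_ge0.
rewrite expnSr exprM -/S exprS -mulrA -/f.
have -> : (2 * #|E|)%:R - K ^+ 2 = - (K ^+ 2 - (2 * #|E|)%:R) by rewrite opprB.
rewrite normrN (le_trans _ (lerB_dist _ _))// normrX normr_nat lerBrDr.
rewrite (le_trans _ K2)// natrM -sS -subr_ge0.
have -> : ((2 + f) * S) ^+ 2 - ((2 + 4 * f) * S ^+ 2 + 2 * S ^+ 2) = (f * S) ^+ 2.
  by ring.
by rewrite exprn_ge0// mulr_ge0.
Qed.

(** Going up the tower of quadratic extensions iterates x -> 2 - x^2 on K / sqrt q, which escapes to infinity from any x with |x| > 2; but
  kloos1_square_order bounds it by 12 q + 27 on all floors that are high enough.
  *)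
Theorem weil_kloosterman (R : realType) (F : finFieldType) (psi : F -> R[i]) (a : F) :
  isAddChar psi -> a != 0 -> `|kloos1 psi a| <= (2 * Num.sqrt #|F|%:R)%:C.
Proof.
move=> psiP a0; set q := #|F|.
have q_gt1 : (1 < q)%N by exact: finNzRing_gt1.
pose s : R := Num.sqrt q%:R; rewrite -/s.
have s2 : s ^+ 2 = q%:R by rewrite sqr_sqrtr// ler0n.
have s_gt0 : 0 < s by rewrite sqrtr_gt0 ltr0n ltnW.
pose k : R := complex.Re `|kloos1 psi a|.
have kE : `|kloos1 psi a| = k%:C.
  by rewrite /k; have := normr_ge0 (kloos1 psi a); case: (`|_|) => x y; rewrite lecE /= => /andP[/eqP -> _].
rewrite kE lecR leNgt; apply/negP => k_large.
pose e := k / s - 2.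
have e_gt0 : 0 < e by rewrite subr_gt0 ltr_pdivlMr.
have ke : (2 + e) * s = k by rewrite /e addrC subrK divfK// gt_eqF.
(* The floor m + 1 has order r^2 with r = q^(2^m) > m, and 4^(m + 1) > N. *)
pose N := Num.bound ((12 * q + 27)%:R / e).
pose m := (4 * q + 8 + N)%N.
have large : (2 + e%:C) * s%:C <= `|kloos1 psi a|.
  by rewrite kE -ke -(rmorph_nat (real_complex R)) -rmorphD -rmorphM lexx.
have [|||E [chi [b [cardE chiP b0 chi_q growth]]]] :=
    kloos1_tower m.+1 psiP a0 _ _ _ large.
- by rewrite ler0c ltW.
- by rewrite -rmorphXn s2 rmorph_nat.
- by rewrite ler0c ltW.
pose r := (q ^ (2 ^ m))%N.
have cardEr : #|E| = (r ^ 2)%N by rewrite cardE expnSr expnM.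
have r_char : [pchar E].-nat r.
  by have := card_pnat E; rewrite cardEr pnatX orbF.
have m_lt : (m < r)%N.
  rewrite (leq_trans (ltn_expl m (isT : 1 < 2)%N))//.
  by rewrite (leq_trans (ltnW (ltn_expl _ q_gt1))).
have := kloos1_square_order chiP chi_q b0 q_gt1 r_char cardEr.
move=> /(_ _ _)/(le_trans growth); rewrite -/q.
have -> : s%:C ^+ (2 ^ m.+1) = r%:R.
  by rewrite expnS exprM -rmorphXn s2 rmorph_nat natrX.
rewrite natrM ler_pM2r ?ltr0n; last by rewrite expn_gt0 ltnW.
move=> /(_ _ _) bound.
have : (12 * q + 27)%:R < 2 + 4 ^+ m.+1 * e :> R.
  have : (12 * q + 27)%:R / e < N%:R.
    by apply: archi_boundP; rewrite divr_ge0 ?ler0n// ltW.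
  rewrite ltr_pdivrMr// => /lt_le_trans; apply.
  have N_le : N%:R <= (4 ^ m.+1)%N%:R :> R.
    rewrite ler_nat.
    rewrite (leq_trans _ (ltnW (ltn_expl m.+1 (isT : 1 < 4)%N)))//.
    exact: leq_trans (leq_addl _ _) (leqnSn _).
  rewrite natrX in N_le.
  by rewrite -[X in X <= _]add0r lerD// ler_wpM2r// ltW.
rewrite ltNge => /negP; apply; rewrite -lecR.
rewrite rmorphD rmorphM rmorphXn !rmorph_nat.
by apply: bound; rewrite ltnW// (leq_trans _ m_lt)// /m; lia.
Qed.

(** * Matrix Kloosterman sums and stable subspaces *)

Definition mxKloos (C : numClosedFieldType) (F : finFieldType) (psi : F -> C) n
    (a : 'M[F]_n) : C :=
  \sum_(x in unitmx) psi (\tr (a *m x + invmx x)).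

Lemma invmx_uniq (F : fieldType) n (x y : 'M[F]_n) : x *m y = 1%:M -> invmx x = y.
Proof.
move=> xy; have [xu _] := mulmx1_unit xy.
by rewrite -[LHS]mulmx1 -xy mulmxA mulVmx// mul1mx.
Qed.

Lemma invmx_mul (F : fieldType) n (x y : 'M[F]_n) : x \in unitmx -> y \in unitmx ->
  invmx (x *m y) = invmx y *m invmx x.
Proof.
move=> xu yu; apply: invmx_uniq.
by rewrite mulmxA -[x *m y *m _]mulmxA mulmxV// mulmx1 mulmxV.
Qed.

Lemma mulmx_injl (F : fieldType) n p (g : 'M[F]_n) : g \in unitmx ->
  injective (fun x : 'M[F]_(n, p) => g *m x).
Proof. by move=> gu; apply: can_inj (mulKmx gu). Qed.

Lemma mulmx_injr (F : fieldType) n p (g : 'M[F]_n) : g \in unitmx ->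
  injective (fun x : 'M[F]_(p, n) => x *m g).
Proof. by move=> gu; apply: can_inj (mulmxK gu). Qed.

Section MatrixSums.
Variables (C : numClosedFieldType) (F : finFieldType) (psi : F -> C).
Hypothesis psiP : isAddChar psi.
Local Notation q := (#|F|%:R : C).
Local Notation K := (mxKloos psi).

Lemma sum_addchar_mx m n (z : 'M[F]_(n, m)) :
  \sum_(c : 'M[F]_(m, n)) psi (\tr (z *m c)) = if z == 0 then q ^+ (m * n) else 0.
Proof.
have [->|z0] := eqVneq z 0.
  under eq_bigr do rewrite mul0mx mxtrace0 (addchar0 psiP).
  by rewrite sumr_const card_mx natrX.
have [_ _ [u psiu]] := psiP.
have [i [j zij]] : exists i, exists j, z i j != 0.
  apply/not_existsP => nz; case/eqP: z0; apply/matrixP => i j; rewrite mxE.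
  by apply/eqP; apply: contraT => zij; case: (nz i); exists j.
pose c0 := (u / z i j) *: delta_mx j i : 'M[F]_(m, n).
have tr0 : \tr (z *m c0) = u.
  rewrite mxtrace_mulC /mxtrace (bigD1 j)//= big1 => [|k kj].
    rewrite !mxE (bigD1 i)//= big1 => [|k ki]; rewrite !mxE !eqxx/=.
      by rewrite mulr1 !addr0 divfK.
    by rewrite (negPf ki) mulr0 mul0r.
  by rewrite !mxE big1// => l _; rewrite !mxE (negPf kj) mulr0 mul0r.
set S := \sum_c _; apply/eqP; have /eqP : (psi u - 1) * S = 0.
  rewrite mulrBl mul1r {2}/S (reindex_inj (addrI c0)) /= mulr_sumr -sumrB big1// => c _.
  by rewrite mulmxDr mxtraceD tr0 (addcharD psiP) subrr.
by rewrite mulf_eq0 subr_eq0 (negPf psiu).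
Qed.

Lemma tr_conj n (a g x : 'M[F]_n) : g \in unitmx -> x \in unitmx ->
  \tr (a *m (invmx g *m x *m g) + invmx (invmx g *m x *m g)) =
  \tr ((g *m a *m invmx g) *m x + invmx x).
Proof.
move=> gu xu; rewrite !invmx_mul ?unitmx_mul ?unitmx_inv ?gu ?xu// invmxK.
rewrite !mxtraceD; congr (_ + _).
  by rewrite !mulmxA mxtrace_mulC !mulmxA.
by rewrite mxtrace_mulC mulmxK.
Qed.

Lemma sum_conj n (a g : 'M[F]_n) (p : pred 'M[F]_n) : g \in unitmx ->
  \sum_(x in unitmx | p x) psi (\tr (a *m x + invmx x)) =
  \sum_(x in unitmx | p (invmx g *m x *m g))
    psi (\tr ((g *m a *m invmx g) *m x + invmx x)).
Proof.
move=> gu; pose f x := invmx g *m x *m g.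
have f_inj : injective f.
  by move=> x y /(mulmx_injr gu)/(mulmx_injl (_ : invmx g \in unitmx)); apply; rewrite unitmx_inv.
have f_unit x : (f x \in unitmx) = (x \in unitmx).
  by rewrite /f !unitmx_mul unitmx_inv gu andbT.
rewrite (reindex_inj f_inj); apply: eq_big => [x|x /andP[]]; first by rewrite f_unit.
by rewrite f_unit => xu _; rewrite tr_conj.
Qed.

Lemma mxKloos_conj n (a g : 'M[F]_n) : g \in unitmx -> K (g *m a *m invmx g) = K a.
Proof.
move=> gu; have := sum_conj a xpredT gu.
by rewrite /mxKloos; under eq_bigl do rewrite andbT; move=> ->; apply: eq_bigl => x; rewrite andbT.
Qed.

Lemma unitmx_lblock k m (X : 'M[F]_k) (Y : 'M[F]_(m, k)) (X' : 'M[F]_m) :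
  X \in unitmx -> (block_mx X 0 Y X' \in unitmx) = (X' \in unitmx).
Proof. by rewrite !unitmxE det_lblock unitrM => ->. Qed.

Lemma tr_invmx_lblock k m (X : 'M[F]_k) (Y : 'M[F]_(m, k)) (X' : 'M[F]_m) :
  X \in unitmx -> X' \in unitmx ->
  \tr (invmx (block_mx X 0 Y X')) = \tr (invmx X) + \tr (invmx X').
Proof.
move=> Xu Xu'.
have -> : invmx (block_mx X 0 Y X') =
    block_mx (invmx X) 0 (- (invmx X' *m Y *m invmx X)) (invmx X').
  apply: invmx_uniq; rewrite mulmx_block !mulmx0 !mul0mx !addr0 add0r !mulmxV//.
  by rewrite mulmxN !mulmxA mulmxV// mul1mx subrr -scalar_mx_block.
by rewrite mxtrace_block.
Qed.

(** In a basis that starts with the rows of V, the matrix x is block triangular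
  with diagonal blocks X and X' and a free block Y. Since a x + x^-1 has a trace
  that is a sum of functions of X, Y and X', the sum factors, with a matrix
  Kloosterman sum of size m for X'. *)
Lemma sum_stable_subspace k m (V : 'M[F]_(k, k + m)) (a : 'M[F]_(k + m)) (X : 'M[F]_k) (B : C) :
    row_free V -> X \in unitmx -> (forall D : 'M[F]_m, `|K D| <= B) ->
  `|\sum_(x in unitmx | V *m x == X *m V) psi (\tr (a *m x + invmx x))|
    <= q ^+ (k * m) * B.
Proof.
move=> Vfree Xu KB.
pose J : 'M[F]_(k, k + m) := row_mx 1%:M 0.
have [g gu gV] : exists2 g : 'M[F]_(k + m), g \in unitmx & V = J *m g.
  exists (block_mx (col_ebase V) 0 0 1%:M *m row_ebase V).
    by rewrite unitmx_mul row_ebase_unit andbT unitmx_lblock ?unitmx1 ?col_ebase_unit.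
  rewrite mulmxA mul_row_block !mul1mx !mul0mx !addr0.
  rewrite -{1}(mulmx_ebase V) (eqP Vfree) pid_mx_row; congr (_ *m _).
  by rewrite mul_mx_row mulmx1 mulmx0.
rewrite (sum_conj _ _ gu); set b := g *m a *m invmx g.
have condE x : (V *m (invmx g *m x *m g) == X *m V) = (usubmx x == row_mx X 0).
  rewrite gV !mulmxA mulmxK// (inj_eq (mulmx_injr gu)).
  by rewrite -{1}[x]vsubmxK mul_row_col mul1mx mul0mx addr0 mul_mx_row mulmx1 mulmx0.
under eq_bigl do rewrite condE.
pose h (p : 'M[F]_(m, k) * 'M[F]_m) := block_mx X 0 p.1 p.2.
have hE x : usubmx x = row_mx X 0 -> h (dlsubmx x, drsubmx x) = x.
  by move=> ux; rewrite /h /= /block_mx -ux -[RHS]vsubmxK hsubmxK.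
rewrite (reindex_onto h (fun x => (dlsubmx x, drsubmx x))) /=; last first.
  by move=> x /andP[_ /eqP/hE].
rewrite (eq_bigl (fun p => p.2 \in unitmx)); last first.
  move=> [Y X'] /=; rewrite unitmx_lblock// /h /= block_mxKdl block_mxKdr.
  by rewrite /block_mx col_mxKu !eqxx !andbT.
pose c := psi (\tr (ulsubmx b *m X) + \tr (invmx X)).
have -> : \sum_(p : 'M[F]_(m, k) * 'M[F]_m | p.2 \in unitmx)
    psi (\tr (b *m h p + invmx (h p))) =
  c * ((\sum_Y psi (\tr (ursubmx b *m Y))) * K (drsubmx b)).
  rewrite big_distrlr /= mulr_sumr -(pair_big xpredT (fun X' => X' \in unitmx)
    (fun Y X' => psi (\tr (b *m h (Y, X') + invmx (h (Y, X')))))) /=.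
  apply: eq_bigr => Y _; rewrite mulr_sumr; apply: eq_bigr => X' Xu'.
  rewrite -!(addcharD psiP); congr psi.
  rewrite mxtraceD tr_invmx_lblock// -[b in b *m _]submxK mulmx_block mxtrace_block.
  by rewrite mulmx0 add0r !mxtraceD; ring.
rewrite normrM (addchar_norm psiP) mul1r normrM ler_pM//.
rewrite (le_trans (ler_norm_sum _ _ _))//.
under eq_bigr do rewrite (addchar_norm psiP).
by rewrite sumr_const card_mx -natrX mulnC.
Qed.

(** Replacing x with x (1 + l v), where l is a column with v l = 0, adds
  (alpha v x - v x^-1) l to the trace of a x + x^-1, since v is an eigenvector.
  Averaging over the l in the column space of the cokernel of v kills every x for
  which alpha v x - v x^-1 is not a multiple of v. *)
Lemma mxKloos_eigenvector n (a : 'M[F]_n) (v : 'rV[F]_n) (alpha : F) :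
  v *m a = alpha *: v ->
  K a = \sum_(x in unitmx | (alpha *: (v *m x) - v *m invmx x <= v)%MS)
          psi (\tr (a *m x + invmx x)).
Proof.
move=> va; pose L := cokermx v.
have vL : v *m L = 0 by rewrite mulmx_coker.
have subL w : (w <= v)%MS = (w *m L == 0) by rewrite submxE.
clearbody L.
pose u (c : 'cV[F]_n) := 1%:M + L *m c *m v.
have Lv0 c : L *m c *m v *m (L *m c *m v) = 0.
  by rewrite -(mulmxA (L *m c)) !(mulmxA v) vL !mul0mx mulmx0.
have uV c : u c *m (1%:M - L *m c *m v) = 1%:M.
  by rewrite /u mulmxBr mulmx1 mulmxDl mul1mx Lv0 addr0 addrK.
have uu c : u c \in unitmx by have [] := mulmx1_unit (uV c).
pose z x := alpha *: (v *m x) - v *m invmx x.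
have qn0 : q ^+ n != 0.
  by rewrite expf_neq0// pnatr_eq0 -lt0n ltnW// finNzRing_gt1.
apply: (mulfI qn0).
transitivity (\sum_(c : 'cV[F]_n) \sum_(x in unitmx) psi (\tr (a *m x + invmx x + L *m c *m z x))).
  rewrite -[q ^+ n]natrX -[(#|F| ^ n)%N]/((#|F| ^ n)%N).
  have -> : ((#|F| ^ n)%N)%:R * K a = \sum_(c : 'cV[F]_n) K a.
    by rewrite sumr_const card_mx muln1 mulr_natl.
  apply: eq_bigr => c _; rewrite /mxKloos (reindex_inj (mulmx_injr (uu c))) /=.
  apply: eq_big => [x|x]; first by rewrite unitmx_mul uu andbT.
  rewrite unitmx_mul uu andbT => xu; congr psi.
  rewrite invmx_mul// (invmx_uniq (uV c)) /u mulmxDr mulmxBl mulmx1 mul1mx mulmxDr.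
  rewrite !mxtraceD raddfN /= /z mulmxBr !mxtraceD !raddfN /=.
  have -> : \tr (a *m (x *m (L *m c *m v))) = \tr (L *m c *m (alpha *: (v *m x))).
    rewrite scalemxAl -va [RHS]mxtrace_mulC (mulmxA x) (mulmxA a) [LHS]mxtrace_mulC.
    by rewrite !mulmxA.
  by rewrite !mulmxA; ring.
rewrite exchange_big /= mulr_sumr big_mkcondr /=; apply: eq_bigr => x xu.
transitivity (psi (\tr (a *m x + invmx x)) * \sum_(c : 'cV[F]_n) psi (\tr (z x *m L *m c))).
  rewrite mulr_sumr; apply: eq_bigr => c _.
  rewrite mxtraceD (addcharD psiP); congr (_ * psi _).
  by rewrite mxtrace_mulC !mulmxA.
rewrite sum_addchar_mx subL -/(z x) muln1.
by case: ifP; rewrite ?mulr0// mulrC.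
Qed.

End MatrixSums.

(** * Matrices with an eigenvector *)

Section EigenvectorBound.
Variables (C : numClosedFieldType) (F : finFieldType) (psi : F -> C).
Hypothesis psiP : isAddChar psi.
Local Notation q := (#|F|%:R : C).
Local Notation K := (mxKloos psi).

Variables (m : nat) (a : 'M[F]_m.+2) (v : 'rV[F]_m.+2) (alpha : F) (B1 B2 : C).
Hypotheses (v_neq0 : v != 0) (va : v *m a = alpha *: v).
Hypotheses (KB1 : forall D : 'M[F]_m.+1, `|K D| <= B1).
Hypotheses (KB2 : forall D : 'M[F]_m, `|K D| <= B2).

(** The x that survive the averaging, sorted by w = v x. *)
Let S x := (alpha *: (v *m x) - v *m invmx x <= v)%MS.
Let T w := \sum_(x in unitmx | S x && (v *m x == w)) psi (\tr (a *m x + invmx x)).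

Let row_free_v : row_free v.
Proof. by rewrite /row_free rank_rV v_neq0. Qed.

Let B1_ge0 : 0 <= B1. Proof. exact: le_trans (normr_ge0 _) (KB1 0). Qed.
Let B2_ge0 : 0 <= B2. Proof. exact: le_trans (normr_ge0 _) (KB2 0). Qed.

(** If v x is proportional to v, then x stabilizes the line spanned by v. *)
Lemma eigen_part_line w : (w <= v)%MS -> `|T w| <= q ^+ m.+1 * B1.
Proof.
move=> /sub_rVP[lam ->].
have [->|lam0] := eqVneq lam 0.
  rewrite scale0r /T big1 ?normr0 ?mulr_ge0 ?exprn_ge0// => x /andP[xu /andP[_]].
  by rewrite -(mul0mx _ x) (inj_eq (mulmx_injr xu)) (negPf v_neq0).
have vfree : row_free (v : 'M[F]_(1, 1 + m.+1)) by exact: row_free_v.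
have lamu : (lam%:M : 'M[F]_1) \in unitmx by rewrite unitmxE det_scalar1 unitfE.
have := sum_stable_subspace psiP (a : 'M[F]_(1 + m.+1)) vfree lamu KB1.
rewrite mul1n; congr (`|_| <= _); apply: eq_bigl => x.
rewrite mul_scalar_mx; apply: andb_id2l => xu.
rewrite andb_idl// => /eqP vx; rewrite /S vx.
have -> : v *m invmx x = lam^-1 *: v.
  by rewrite -[in RHS](mulmxK xu v) vx scalemxAl scalerA mulVf// scale1r.
by rewrite scalerA -scalerBl scalemx_sub.
Qed.

(** Multiplying alpha w - v x^-1 = tau v by x gives w x = alpha^-1 (v + tau w): x
  stabilizes the plane spanned by v and w, and acts on it in one of q ways. *)
Lemma eigen_part_plane w : ~~ (w <= v)%MS -> `|T w| <= q * (q ^+ (2 * m) * B2).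
Proof.
move=> w_out.
have Sw x : x \in unitmx -> v *m x = w -> S x ->
    alpha != 0 /\ exists t, w *m x = alpha^-1 *: v + t *: w.
  move=> xu vx /sub_rVP[tau]; rewrite vx => e.
  have {}e : alpha *: (w *m x) = v + tau *: w.
    have := congr1 (fun z => z *m x) e.
    by rewrite mulmxBl -scalemxAl mulmxKV// -scalemxAl vx => /eqP; rewrite subr_eq addrC => /eqP.
  have alpha0 : alpha != 0.
    apply: contraNneq w_out => alpha0; move: e; rewrite alpha0 scale0r => /eqP.
    rewrite eq_sym addr_eq0 => /eqP e.
    have tau0 : tau != 0.
      by apply: contraNneq v_neq0 => tau0; rewrite e tau0 scale0r oppr0.
    by rewrite e -scaleNr eqmx_scale ?oppr_eq0.
  split=> //; exists (alpha^-1 * tau).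
  by rewrite -scalerA -scalerDr -e scalerA mulVf// scale1r.
have [alpha0|alpha0] := eqVneq alpha 0.
  rewrite /T big1 ?normr0 ?mulr_ge0 ?exprn_ge0 ?ler0n// => x /andP[xu /andP[Sx /eqP vx]].
  by have [] := Sw x xu vx Sx; rewrite alpha0 eqxx.
pose V : 'M[F]_(1 + 1, (1 + 1) + m) := col_mx v w.
pose X t : 'M[F]_(1 + 1) := block_mx 0 1%:M (alpha^-1)%:M t%:M.
have VX (t : F) (x : 'M[F]_((1 + 1) + m)) :
    (V *m x == X t *m V) = (v *m x == w) && (w *m x == alpha^-1 *: v + t *: w).
  rewrite /V /X mul_col_mx mul_block_col mul0mx add0r mul1mx !mul_scalar_mx.
  by apply/eqP/andP => [/eq_col_mx[-> ->]|[/eqP -> /eqP ->]].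
have Xu t : X t \in unitmx.
  (* The second matrix is the inverse of X t. *)
  have [] // := @mulmx1_unit _ _ (X t) (block_mx (- (alpha * t))%:M alpha%:M 1%:M 0).
  rewrite /X mulmx_block !(mul0mx, mulmx0, mul1mx, mulmx1, add0r, addr0).
  rewrite -!scalar_mxM -raddfD /= mulrN mulrA mulVf// mul1r addNr.
  by rewrite scalar_mx_block raddf0.
have Vfree : row_free V.
  rewrite -kermx_eq0; apply/rowV0P => u; rewrite sub_kermx -{1}[u]hsubmxK /V mul_row_col.
  rewrite [lsubmx u]mx11_scalar [rsubmx u]mx11_scalar !mul_scalar_mx.
  set y := lsubmx u 0 0; set z := rsubmx u 0 0 => /eqP e.
  have z0 : z = 0.
    apply/eqP; apply: contraNT w_out => z0.
    have -> : w = (- (z^-1 * y)) *: v.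
      rewrite -[LHS]scale1r -(mulVf z0) -!scalerA scaleNr -scalerA -scalerN.
      by congr (_ *: _); apply/eqP; rewrite -addr_eq0 addrC e.
    by rewrite scalemx_sub.
  have y0 : y = 0.
    by move/eqP: e; rewrite z0 scale0r addr0 scaler_eq0 (negPf v_neq0) orbF => /eqP.
  rewrite -[u]hsubmxK [lsubmx u]mx11_scalar [rsubmx u]mx11_scalar -/y -/z y0 z0.
  by rewrite raddf0 row_mx0.
have -> : T w = \sum_t \sum_(x in unitmx | V *m x == X t *m V) psi (\tr (a *m x + invmx x)).
  rewrite (exchange_big_dep (fun x => x \in unitmx))/=; last by move=> t x _ /andP[].
  rewrite /T big_mkcondr; apply: eq_bigr => x xu.
  under [RHS]eq_bigl do rewrite xu VX.
  case: ifP => [/andP[Sx /eqP vx]|nS].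
    have [_ [t wx]] := Sw x xu vx Sx.
    rewrite (big_pred1 t)// => t' /=; rewrite vx wx eqxx /=.
    rewrite (inj_eq (addrI _)) -subr_eq0 -scalerBl scaler_eq0 subr_eq0 eq_sym.
    have /negPf -> : w != 0 by apply: contraNneq w_out => ->; rewrite sub0mx.
    by rewrite orbF.
  rewrite big_pred0// => t /=; apply/negP => /andP[/eqP vx /eqP wx].
  move/negP: nS; apply; rewrite vx eqxx andbT /S vx.
  have -> : v *m invmx x = alpha *: (w - t *: v).
    rewrite -(mulmxK xu w) wx mulmxDl -!scalemxAl -[X in t *: (X *m _)]vx mulmxK//.
    by rewrite addrK scalerA divff// scale1r.
  by rewrite scalerBr opprB addrCA subrr addr0 scalerA scalemx_sub.
rewrite (le_trans (ler_norm_sum _ _ _))// [q * _]mulr_natl.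
rewrite -sumr_const; apply: ler_sum => t _.
exact: (sum_stable_subspace psiP (a : 'M[F]_((1 + 1) + m)) Vfree (Xu t) KB2).
Qed.

(** There are q vectors w on the line of v, and at most q^(m + 2) outside. *)
Lemma mxKloos_eigenvector_bound :
  `|K a| <= q ^+ m.+2 * B1 + q ^+ (3 * m + 3) * B2.
Proof.
rewrite (mxKloos_eigenvector psiP va).
rewrite (partition_big (fun x => v *m x) xpredT)//=.
rewrite (eq_bigr T); last by move=> w _; apply: eq_bigl => x; rewrite -andbA.
rewrite (bigID (fun w : 'rV[F]_m.+2 => (w <= v)%MS)) /= (le_trans (ler_normD _ _))//.
apply: lerD; rewrite (le_trans (ler_norm_sum _ _ _))//.
  rewrite (le_trans (ler_sum _ (fun w wv => eigen_part_line wv)))// sumr_const.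
  rewrite -[leLHS]mulr_natl [q ^+ m.+2]exprS -mulrA ler_wpM2r ?mulr_ge0 ?exprn_ge0// ler_nat.
  rewrite -[X in (_ <= X)%N](cardsT F).
  apply: leq_trans (leq_imset_card (fun lam => lam *: v) [set: F]).
  apply/subset_leq_card/fintype.subsetP => w; rewrite unfold_in => /sub_rVP[lam ->].
  exact: imset_f.
rewrite (le_trans (ler_sum _ (fun w wv => eigen_part_plane wv)))// sumr_const.
rewrite -[leLHS]mulr_natl mulrA mulrA ler_wpM2r//.
have -> : q ^+ (3 * m + 3) = q ^+ m.+2 * q * q ^+ (2 * m).
  by rewrite -exprSr -exprD; congr (_ ^+ _); lia.
rewrite mulrA !ler_wpM2r ?exprn_ge0 ?ler0n// -natrX ler_nat.
by rewrite (leq_trans (max_card _))// card_mx mul1n.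
Qed.

End EigenvectorBound.

(** * Matrices without eigenvectors *)

Definition eigenfree (F : fieldType) n (b : 'M[F]_n) :=
  forall (v : 'rV[F]_n) (alpha : F), v *m b = alpha *: v -> v = 0.

(** Without eigenvectors, a stable subspace cannot have codimension one in another
  one, so that n / 2 rows are enough to generate the F[b]-module of all rows. An
  intertwiner y is determined by its values on generators. In the induction, W is
  a subspace on which any intertwiner that kills U must vanish; it has at least
  twice as many dimensions as U has rows. *)
Lemma eigenfree_generators (F : fieldType) n (b : 'M[F]_n) : eigenfree b ->
  exists u (U : 'M[F]_(u, n)), (2 * u <= n)%N /\
    forall y c : 'M[F]_n, b *m y = y *m c -> U *m y = 0 -> y = 0.
Proof.
move=> bfree.
suff gen r : (r <= n)%N -> exists u (U : 'M[F]_(u, n)) (W : 'M[F]_n),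
    [/\ (2 * u <= \rank W)%N, (r <= \rank W)%N &
      forall y c : 'M[F]_n, b *m y = y *m c -> U *m y = 0 -> (W <= kermx y)%MS].
  have [u [U [W [uW nW WU]]]] := gen n (leqnn n).
  exists u, U; split=> [|y c byc Uy]; first exact: leq_trans uW (rank_leq_col W).
  have Wfull : row_full W by rewrite /row_full eqn_leq rank_leq_col nW.
  have := submx_trans (submx_full (1%:M : 'M[F]_n) Wfull) (WU y c byc Uy).
  by rewrite sub_kermx mul1mx => /eqP.
elim: r => [_|r IHr rn].
  exists 0, 0, 0; split=> // y c _ _; exact: sub0mx.
have [u [U [W [uW rW WU]]]] := IHr (ltnW rn).
have [lt_rW|] := ltnP r (\rank W); first by exists u, U, W.
move=> le_Wr; have {le_Wr rW} rkW : \rank W = r by apply/eqP; rewrite eqn_leq le_Wr.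
have [stab|nstab] := boolP (W *m b <= W)%MS; last first.
  have ltW : (W < W + W *m b)%MS by rewrite ltmxE addsmxSl addsmx_sub submx_refl.
  have rk_lt := rank_ltmx ltW.
  exists u, U, (W + W *m b)%MS; split=> [||y c byc Uy].
  - exact: leq_trans uW (ltnW rk_lt).
  - by rewrite -rkW.
  rewrite addsmx_sub (WU y c)//= sub_kermx -mulmxA byc mulmxA.
  by have := WU y c byc Uy; rewrite sub_kermx => /eqP ->; rewrite mul0mx.
have /row_subPn[i vW] : ~~ (1%:M <= W)%MS.
  by apply/negP => /mxrankS; rewrite mxrank1 rkW leqNgt rn.
set v := row i 1%:M in vW.
have ltWv : (W < W + v)%MS by rewrite ltmxE addsmxSl addsmx_sub submx_refl.
(* Otherwise v b = w + lambda v with w in W, and b - lambda, which is injective,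
   would map W + v into W. *)
have vb : ~~ (v *m b <= W + v)%MS.
  apply/negP => /sub_addsmxP[[c1 c2] /= vbE].
  pose b' := b - (c2 0 0)%:M.
  have b'free : row_free b'.
    rewrite -kermx_eq0; apply/rowV0P => z; rewrite sub_kermx mulmxBr mul_mx_scalar.
    by rewrite subr_eq0 => /eqP/bfree.
  have le : ((W + v)%MS *m b' <= W)%MS.
    rewrite (eqmxMr _ (addsmxE _ _)) mul_col_mx -addsmxE addsmx_sub; apply/andP; split.
      by rewrite mulmxBr mul_mx_scalar addmx_sub// -scaleN1r scalerA scalemx_sub.
    rewrite mulmxBr vbE [c2]mx11_scalar mul_scalar_mx mul_mx_scalar !mxE eqxx mulr1n addrK.
    exact: submxMl.
  have := leq_trans (mxrankS le) (leqnn _).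
  by rewrite mxrankMfree// leqNgt (rank_ltmx ltWv).
have ltWvb : (W + v < W + v + v *m b)%MS by rewrite ltmxE addsmxSl addsmx_sub submx_refl.
exists (u + 1)%N, (col_mx U v), (W + v + v *m b)%MS; split=> [||y c byc].
- have := rank_ltmx ltWv; have := rank_ltmx ltWvb; lia.
- by have := rank_ltmx ltWv; have := rank_ltmx ltWvb; lia.
rewrite mul_col_mx => /eqP; rewrite col_mx_eq0 => /andP[/eqP Uy /eqP vy].
rewrite !addsmx_sub (WU y c)//= !sub_kermx vy eqxx /=.
by rewrite -mulmxA byc mulmxA vy mul0mx.
Qed.

Lemma card_intertwiners (F : finFieldType) n (b c : 'M[F]_n) : eigenfree b ->
  (#|[set y : 'M[F]_n | b *m y == y *m c]| <= #|F| ^ (n * n./2))%N.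
Proof.
move=> /eigenfree_generators[u [U [un Uinj]]].
rewrite -(@card_in_imset _ _ (mulmx U)).
  rewrite (leq_trans (max_card _))// card_mx leq_pexp2l ?(ltnW (finNzRing_gt1 F))//.
  rewrite mulnC leq_mul//; lia.
move=> y z; rewrite !inE => /eqP yc /eqP zc Uyz.
apply/eqP; rewrite -subr_eq0; apply/eqP; apply: (Uinj _ c).
  by rewrite mulmxBr mulmxBl yc zc.
by rewrite mulmxBr Uyz subrr.
Qed.

Section SecondMoment.
Variables (C : numClosedFieldType) (F : finFieldType) (psi : F -> C).
Hypothesis psiP : isAddChar psi.
Local Notation q := (#|F|%:R : C).
Local Notation K := (mxKloos psi).
Variable n : nat.
Local Notation GL := [set x : 'M[F]_n | x \in unitmx].

(** Parseval's identity: b -> K b is the Fourier transform of x -> psi(tr x^-1) on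
  the invertible matrices. *)
Lemma mxKloos_parseval :
  \sum_(b : 'M[F]_n) `|K b| ^+ 2 = q ^+ (n * n) * #|GL|%:R.
Proof.
pose G (x y : 'M[F]_n) := psi (\tr (invmx x) - \tr (invmx y)).
transitivity (\sum_(b : 'M[F]_n) \sum_(x in unitmx) \sum_(y in unitmx)
    G x y * psi (\tr ((x - y) *m b))).
  apply: eq_bigr => b _; rewrite normCK rmorph_sum /= big_distrlr /=.
  apply: eq_bigr => x _; apply: eq_bigr => y _.
  rewrite (addchar_conj psiP) -!(addcharD psiP); congr psi.
  by rewrite mulmxBl !mxtraceD !raddfN /= ![\tr (b *m _)]mxtrace_mulC; ring.
rewrite exchange_big /=.
under eq_bigr do rewrite exchange_big /=.
transitivity (\sum_(x : 'M[F]_n | x \in unitmx) q ^+ (n * n)).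
  apply: eq_bigr => x xu; rewrite (bigD1 x)//= [X in _ + X]big1 => [|y /andP[_ yx]].
    rewrite -mulr_sumr (sum_addchar_mx psiP) subrr eqxx /G subrr (addchar0 psiP).
    by rewrite mul1r addr0.
  by rewrite -mulr_sumr (sum_addchar_mx psiP) subr_eq0 eq_sym (negPf yx) mulr0.
rewrite sumr_const mulr_natr; congr (_ *+ _).
by apply: eq_card => x; rewrite !inE.
Qed.

(** K is constant on the conjugacy class of a. The second moment over this class is
  at most q^(n^2) #|GL|, and the class is large because at most q^(n (n / 2))
  elements of GL conjugate a to a given b. *)
Lemma mxKloos_eigenfree_bound (a : 'M[F]_n) : eigenfree a ->
  `|K a| ^+ 2 <= q ^+ (n * n + n * n./2).
Proof.
move=> afree.
pose conj g := g *m a *m invmx g.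
have conj_free g : g \in unitmx -> eigenfree (conj g).
  move=> gu v alpha e; suff : v *m g = 0.
    by move/(congr1 (mulmx^~ (invmx g))); rewrite mulmxK// mul0mx.
  apply: (afree _ alpha); rewrite scalemxAl -e /conj.
  by rewrite !mulmxA -[RHS]mulmxA mulVmx// mulmx1.
have GL_gt0 : 0 < #|GL|%:R :> C.
  by rewrite ltr0n; apply/card_gt0P; exists 1%:M; rewrite inE unitmx1.
rewrite -(ler_pM2l GL_gt0) exprD [leRHS]mulrA [#|GL|%:R * _ ^+ (n * n)%N]mulrC -mxKloos_parseval.
have -> : #|GL|%:R * `|K a| ^+ 2 = \sum_(g in GL) `|K (conj g)| ^+ 2.
  rewrite mulr_natl -sumr_const; apply: eq_bigr => g; rewrite inE => gu.
  by rewrite (mxKloos_conj psi).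
rewrite (partition_big conj xpredT)//= mulr_suml; apply: ler_sum => b _.
rewrite (eq_bigr (fun=> `|K b| ^+ 2)); last by move=> g /andP[_ /eqP ->].
rewrite sumr_const -[leLHS]mulr_natr ler_wpM2l ?exprn_ge0// -natrX ler_nat.
have [/existsP[g0 /andP[]]|none] := boolP [exists g, (g \in GL) && (conj g == b)].
  rewrite inE => g0u /eqP <-.
  apply: leq_trans (card_intertwiners a (conj_free g0 g0u)).
  apply/subset_leq_card/fintype.subsetP => g; rewrite unfold_in !inE.
  by move=> /andP[gu /eqP <-]; rewrite /conj mulmxKV.
rewrite eq_card0// => g; rewrite unfold_in; apply: contraNF none => gP.
by apply/existsP; exists g.
Qed.

End SecondMoment.

(** * The bound for all matrices *)

Lemma kloos1_bound (R : realType) (F : finFieldType) (psi : F -> R[i]) (a : F) :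
  isAddChar psi -> `|kloos1 psi a| <= (2 * Num.sqrt #|F|%:R)%:C.
Proof.
move=> psiP; have [->|a0] := eqVneq a 0; last exact: weil_kloosterman.
have -> : kloos1 psi 0 = - 1.
  apply/eqP; rewrite -addr_eq0 addrC -(sum_addchar1 psiP) (bigD1 0)//= (addchar0 psiP).
  by apply/eqP; congr (_ + _); apply: eq_bigr => x _; rewrite mul0r addr0.
rewrite normrN1 -[1](rmorph1 (real_complex R)) lecR.
have : 1 <= Num.sqrt #|F|%:R :> R by rewrite -[X in X <= _]sqrtr1 ler_sqrt// ler1n ltnW// finNzRing_gt1.
lra.
Qed.

Lemma mxKloos_dim1 (C : numClosedFieldType) (F : finFieldType) (psi : F -> C)
    (a : 'M[F]_1) : mxKloos psi a = kloos1 psi (a 0 0).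
Proof.
rewrite /mxKloos (reindex_onto (fun y : F => y^-1%:M) (fun x => (x 0 0)^-1)) /=; last first.
  by move=> x _; rewrite invrK -mx11_scalar.
apply: eq_big => [y|y /andP[yu _]].
  by rewrite unitmxE det_scalar1 unitfE invr_eq0 !mxE eqxx mulr1n invrK eqxx andbT.
congr psi; rewrite {1}[a]mx11_scalar -scalar_mxM invmx_scalar invrK -raddfD /=.
by rewrite mxtrace_scalar mulr1n addrC.
Qed.

Section Bound.
Variables (R : realType) (F : finFieldType) (psi : F -> R[i]).
Hypothesis psiP : isAddChar psi.
Local Notation K := (mxKloos psi).
Let s : R := Num.sqrt #|F|%:R.

Let s2 : s ^+ 2 = #|F|%:R. Proof. by rewrite sqr_sqrtr// ler0n. Qed.

Let s_ge1 : 1 <= s.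
Proof. by rewrite -[X in X <= _]sqrtr1 ler_sqrt// ler1n ltnW// finNzRing_gt1. Qed.

Let s_ge0 : 0 <= s. Proof. exact: le_trans s_ge1. Qed.

Let qE k : (#|F|%:R : R[i]) ^+ k = (s ^+ (2 * k))%:C.
Proof. by rewrite exprM s2 -[LHS]natrX -natrX rmorph_nat. Qed.

(** The exponent of s = sqrt q is the integer part of 3 n^2 / 2, which is twice the
  exponent (3 n^2 - delta n) / 4 of q. For an eigenfree matrix, the second moment
  gives n^2 + n (n / 2), no larger. Otherwise the step from m to m + 2 multiplies
  by q^(3 m + 3), which is exactly the growth of the bound, and the step from
  m + 1 to m + 2 leaves room to spare; the Weil bound starts the induction at 1. *)
Lemma mxKloos_bound n (a : 'M[F]_n) :
  `|K a| <= (2 ^+ n * s ^+ (3 * n ^ 2)./2)%:C.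
Proof.
elim/ltn_ind: n a => n IHn a.
have [afree|/existsNP[v /existsNP[alpha /not_implyP[va /eqP v0]]]] := pselect (eigenfree a).
  have le2 : (n * n + n * n./2 <= (3 * n ^ 2)./2)%N.
    have := odd_double_half n; have := leq_b1 (odd n); set k := n./2; move: (nat_of_bool _) => o o1 nE.
    by rewrite -nE; nia.
  apply: (@le_trans _ _ (s ^+ (n * n + n * n./2))%:C).
    rewrite -(@ler_pXn2r _ 2)// ?nnegrE ?normr_ge0 ?ler0c ?exprn_ge0//.
    have -> : (s ^+ (n * n + n * n./2))%:C ^+ 2 = #|F|%:R ^+ (n * n + n * n./2).
      by rewrite qE [(2 * _)%N]mulnC exprM [RHS]rmorphXn.
    exact: (mxKloos_eigenfree_bound psiP afree).
  rewrite lecR -[X in X <= _]mul1r ler_pM ?exprn_ge0 ?ler01//.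
    by rewrite exprn_ege1// ler1n.
  exact: ler_weXn2l.
case: n => [|[|m]] in a v alpha va v0 IHn *.
- by case/eqP: v0; apply/matrixP => i [].
- rewrite mxKloos_dim1 !expr1; exact: kloos1_bound.
have IH1 := IHn m.+1 (ltnSn _); have IH2 := IHn m (ltnW (ltnSn _)).
rewrite (le_trans (mxKloos_eigenvector_bound psiP v0 va IH1 IH2))//.
rewrite !qE -!rmorphM -rmorphD lecR.
rewrite mulrCA -exprD [s ^+ (2 * _) * (_ * _)]mulrCA -exprD.
have e1 : (2 * m.+2 + (3 * m.+1 ^ 2)./2 <= (3 * m.+2 ^ 2)./2)%N by lia.
have e2 : (2 * (3 * m + 3) + (3 * m ^ 2)./2 <= (3 * m.+2 ^ 2)./2)%N by lia.
apply: (@le_trans _ _ ((2 ^+ m.+1 + 2 ^+ m) * s ^+ (3 * m.+2 ^ 2)./2)).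
  by rewrite mulrDl lerD// ler_wpM2l ?exprn_ge0// ler_weXn2l.
rewrite ler_wpM2r ?exprn_ge0// !exprS.
have : 0 <= 2 ^+ m :> R by rewrite exprn_ge0.
lra.
Qed.

End Bound.

(** * The canonical additive character *)

(** By the linear independence of the automorphisms. *)
Lemma galTrace_neq0 (F0 : fieldType) (L : splittingFieldType F0) (K E : {subfield L}) :
  exists2 x, x \in E & galTrace K E x != 0.
Proof.
have [x xE nz] := @gal_independent_contra F0 L E
  (fun y => y \in ('Gal(E / K))%g) (fun=> 1) 1%g (group1 _) (oner_neq0 _).
exists x => //; apply: contraNneq nz => tr0.
by rewrite -[X in _ == X]tr0; apply/eqP; apply: eq_bigr => y _; exact: mul1r.
Qed.

Section CanonicalCharacter.
Variables (R : realType) (F : finFieldType) (p : nat) (chFp : p \in [pchar F]).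

Let p_prime : prime p. Proof. exact: pcharf_prime chFp. Qed.
Let p_neq0 : (p%:R : R) != 0. Proof. by rewrite pnatr_eq0 -lt0n prime_gt0. Qed.

Definition expi (t : R) : R[i] := cos t +i* sin t.

Lemma expiD t u : expi (t + u) = expi t * expi u.
Proof. by rewrite /expi cosD sinD; simpc; congr (_ +i* _); ring. Qed.

Lemma expi_norm t : `|expi t| = 1.
Proof. by rewrite normc_def /= cos2Dsin2 sqrtr1. Qed.

Let w := expi (2 * pi / p%:R).

Lemma expi_natmul k : expi (2 * pi / p%:R * k%:R) = w ^+ k.
Proof.
elim: k => [|k IHk]; first by rewrite mulr0 expr0 /expi cos0 sin0.
by rewrite exprS -IHk -expiD -natr1; congr expi; ring.
Qed.

Let w_p : w ^+ p = 1.
Proof.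
rewrite -expi_natmul divfK// /expi mulr_natl.
by rewrite cos2pi sin2pi.
Qed.

(** The half-angle formula, the sine of pi / p being positive. *)
Lemma w_neq1 : w != 1.
Proof.
apply/eqP => /(congr1 (@complex.Re R)) /=.
have -> : 2 * pi / p%:R = pi / p%:R + pi / p%:R :> R by ring.
rewrite cosD.
have sin_gt0 : 0 < sin (pi / p%:R) :> R.
  apply: sin_gt0_pi; rewrite divr_gt0 ?pi_gt0 ?ltr0n ?prime_gt0//=.
  rewrite ltr_pdivrMr ?ltr0n ?prime_gt0// ltr_pMr ?pi_gt0// ltr1n.
  exact: prime_gt1.
have := cos2Dsin2 (pi / p%:R : R); move: sin_gt0; set c := cos _; set t := sin _.
move=> t0 ct e; have : 0 < t * t by rewrite mulr_gt0.
by move: ct e; rewrite !expr2; lra.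
Qed.

Lemma addCharE x : addChar R chFp x = w ^+ (absTrace chFp x : nat).
Proof.
rewrite -expi_natmul /addChar /cexp; set k := nat_of_ord _.
have -> : 2 * (pi : R)%:C * 'i%C * k%:R / p%:R = 0 +i* (2 * pi / p%:R * k%:R).
  have -> : 2 * (pi : R)%:C * 'i%C * k%:R / p%:R = (2 * pi / p%:R * k%:R)%:C * 'i%C.
    rewrite !rmorphM fmorphV !rmorph_nat; ring.
  by simpc.
by rewrite /= expR0 rmorph1 mul1r.
Qed.

Lemma absTraceD : {morph absTrace chFp : x y / x + y}.
Proof.
by move=> x y; rewrite /absTrace -[x + y]/((x : pPrimeCharType chFp) + y) !raddfD.
Qed.

Lemma absTrace_neq0 : exists x, absTrace chFp x != 0.
Proof.
pose K := pPrimeCharType chFp.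
have [x _ nz] := galTrace_neq0 (1%AS : {subfield K}) {:K}%AS.
exists x; apply: contraNneq nz => t0.
by rewrite -(absTraceE chFp x) t0 scale0r.
Qed.

Lemma addChar_isAddChar : isAddChar (addChar R chFp).
Proof.
have expw_mod k : w ^+ (k %% p) = w ^+ k.
  by rewrite [in RHS](divn_eq k p) exprD mulnC exprM w_p expr1n mul1r.
split.
- move=> x y; rewrite !addCharE absTraceD -exprD.
  rewrite -[RHS]expw_mod; congr (_ ^+ _).
  by rewrite -[X in _ = (_ %% X)%N](Fp_cast p_prime).
- by move=> x; rewrite addCharE normrX expi_norm expr1n.
have [x tx] := absTrace_neq0; set t := absTrace chFp x in tx.
exists (x *+ (t^-1 : 'F_p)).
have traceMn k : absTrace chFp (x *+ k) = t *+ k.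
  elim: k => [|k IHk]; last by rewrite !mulrS absTraceD IHk.
  by rewrite !mulr0n; apply: (addIr t); rewrite -absTraceD !add0r.
rewrite addCharE traceMn -mulr_natr natr_Zp mulfV//.
rewrite (_ : nat_of_ord (1 : 'F_p) = 1%N) ?expr1 ?w_neq1//.
Qed.

End CanonicalCharacter.

Theorem theorem1p8 (R : realType) (n : nat) (hn : (1 <= n)%N) :
  exists C : R,
    forall (F : finFieldType) (p : nat) (chFp : p \in [pchar F]) (a : 'M[F]_n),
      a \in unitmx ->
      `|Kloosterman R chFp a|
        <= (C * #|F|%:R `^ ((3 * n%:R ^+ 2 - (delta n)%:R) / 4))%:C.
Proof.
exists (2 ^+ n) => F p chFp a _.
have -> : (3 * n%:R ^+ 2 - (delta n)%:R) / 4 = 2^-1 * (3 * n ^ 2)./2%:R :> R.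
  have oddE : odd (3 * n ^ 2) = odd n by rewrite oddM oddX.
  have -> : 3 * n%:R ^+ 2 = (delta n)%:R + 2 * (3 * n ^ 2)./2%:R :> R.
    rewrite -natrX -!natrM -natrD -[in LHS](odd_double_half (3 * n ^ 2)) oddE.
    by rewrite -mul2n /delta; case: (odd n).
  by field.
rewrite powRrM powR12_sqrt ?ler0n// powR_mulrn ?sqrtr_ge0//.
exact: (mxKloos_bound (addChar_isAddChar R chFp)).
Qed.
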